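(* Let $H$ be an infinite dimensional complex Hilbert space and let $T \in \overline{\mathcal{AN}(H)}$ be a $\ast$-paranormal operator. If $N(T) = N(T^* )$, then $T$ is normal.
   Context: $N(\cdot)$ denotes the null space. An operator $T \in \mathcal{B}(H)$ (bounded linear operators on $H$) is absolutely norm attaining, written $T \in \mathcal{AN}(H)$, if for every nonzero closed subspace $L$ of $H$ there is a unit vector $x \in L$ with $\|Tx\| = \|T|_L\|$. $\overline{\mathcal{AN}(H)}$ is the closure of $\mathcal{AN}(H)$ in the operator norm. $T$ is $\ast$-paranormal if $\|T^*x\|^2 \leq \|T^2x\|\,\|x\|$ for all $x \in H$. *)

(* Defs.v *)
From HB Require Import structures.
From mathcomp Require Import all_boot all_order all_algebra.
From mathcomp Require Import sesquilinear.
From mathcomp Require Import all_classical reals topology normedtype.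
From mathcomp Require Import complex.

Set Implicit Arguments.
Unset Strict Implicit.
Unset Printing Implicit Defensive.

Import Order.TTheory GRing.Theory Num.Theory.
Import numFieldNormedType.Exports.

Local Open Scope classical_set_scope.
Local Open Scope ring_scope.
Local Open Scope complex_scope.

(* [inner] is linear in its first argument and conjugate-linear in the second;
   positive definiteness is part of the [{dot _ for _}] structure. *)
HB.mixin Record CompleteNormedModule_isHilbert (R : realType) H
    of CompleteNormedModule R[i] H := {
  inner : {dot H for (@Num.conj R[i])} ;
  sqr_norm_inner : forall x : H, `|x| ^+ 2 = inner x x
}.

#[short(type="hilbertType")]
HB.structure Definition Hilbert (R : realType) :=
  {H of CompleteNormedModule R[i] H & CompleteNormedModule_isHilbert R H}.

Section Operators.
Context {R : realType} {H : hilbertType R}.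

Definition finite_dimensional : Prop :=
  exists s : seq H, forall x : H,
    exists c : nat -> R[i], x = \sum_(k < size s) c k *: s`_k.

Definition closed_subspace (L : set H) : Prop :=
  [/\ closed L, L 0 & forall (a : R[i]) x y, L x -> L y -> L (a *: x + y)].

(* The norm of [H] takes its values in [R[i]], hence the real part. *)
Definition opnorm_on (L : set H) (f : H -> H) : R :=
  sup [set complex.Re `|f x| | x in [set x | L x /\ `|x| <= 1]].

Definition opnorm (f : H -> H) : R := opnorm_on setT f.

(* For linear maps, continuity is boundedness: see
   [linear_bounded_continuous]. *)
Definition bounded_operator : set {linear H -> H} := [set T | continuous T].

Definition absolutely_norm_attaining : set {linear H -> H} :=
  [set T | bounded_operator T /\
    forall L : set H, closed_subspace L -> L != [set 0] ->
      exists x : H, [/\ L x, `|x| = 1 & `|T x| = (opnorm_on L T)%:C]].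

Definition opnorm_closure (A : set {linear H -> H}) : set {linear H -> H} :=
  [set T | bounded_operator T /\
    forall e : R, 0 < e -> exists2 S, A S & opnorm (T \- S) < e].

(* For a bounded operator [T] the vector [z] exists (Riesz representation) and
   is unique; the default value [0] is then irrelevant. *)
Definition adjoint (T : H -> H) : H -> H := fun y =>
  xget 0 [set z | forall x : H, inner (T x) y = inner x z].

Definition null_space (f : H -> H) : set H := f @^-1` [set 0].

Definition star_paranormal (T : H -> H) : Prop :=
  forall x : H, `|adjoint T x| ^+ 2 <= `|T (T x)| * `|x|.

Definition normal_operator (T : H -> H) : Prop :=
  forall x : H, adjoint T (T x) = T (adjoint T x).

End Operators.

Arguments finite_dimensional {R} H.
Arguments absolutely_norm_attaining {R} H.

(* Main.v *)
Require Import Defs.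
From HB Require Import structures.
From mathcomp Require Import all_boot all_order all_algebra.
From mathcomp Require Import sesquilinear complex.
From mathcomp Require Import all_classical reals topology normedtype.
From mathcomp Require Import sequences exp.
From mathcomp Require Import ring lra.

(* An operator [S] attaining its norm on every closed subspace has an essential
   modulus: there is [b] such that, up to any [e], [|S x| = b |x|] on the
   orthogonal complement of a finite set.  Otherwise one finds an orthonormal
   sequence [f n] with the [S (f n)] pairwise orthogonal and [|S (f n)|]
   strictly increasing, and the norm of [S] on its closed span is not attained.
   This property passes to norm limits, and it implies that approximate
   eigenvectors of [T* T] for [rho ^ 2 <> b ^ 2] have cluster points.

   Star-paranormality yields [|T y| ^ 3 <= |T ^ 3 y| |y| ^ 2].  In terms of the
   gain [r y = |T y| / |y|] this reads [r y ^ 2 <= r (T y) r (T (T y))], so that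
   [r y ^ 2 * r (T y)] is monotone along orbits and the gain converges along
   forward and backward orbits; at the limit [rho], the normalized orbit [u n]
   satisfies [T (u n) ~ rho u (n + 1)] and [T* (u (n + 1)) ~ rho u n].  Let [H1]
   be the orthogonal complement of the largest reducing subspace on which [T] is
   normal.  If the orbit lies in [H1], then [rho = b]: a cluster point of [u]
   would generate a reducing subspace on which [T] is normal.  As [T] is
   bijective on [H1], comparing the two ends of an orbit shows that
   [r y ^ 2 * r (T y)] is constant on [H1], which is the equality case of
   star-paranormality: every vector of [H1] is an eigenvector of [T* T].  Hence
   [T] is a multiple of a unitary on [H1], and so [H1 = 0]. *)

Set Implicit Arguments.
Unset Strict Implicit.
Unset Printing Implicit Defensive.

Import Order.TTheory GRing.Theory Num.Theory.
Import numFieldNormedType.Exports.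

Local Open Scope classical_set_scope.
Local Open Scope ring_scope.
Local Open Scope complex_scope.

(** * The underlying real inner product *)

Section RealStructure.
Context {R : realType} {H : hilbertType R}.
Implicit Types (x y z : H) (t : R).

Definition nrm x : R := complex.Re `|x|.

(** Orthogonality is weaker for [rip] than for [inner], but [rip] determines norms and separates
    points. *)
Definition rip x y : R := complex.Re (inner x y).

Lemma normE x : `|x| = (nrm x)%:C.
Proof. by rewrite /nrm RRe_real // ger0_real. Qed.

Lemma innerC x y : inner x y = (inner y x)^*%C.
Proof.
have := hermC (@inner R H) x y; rewrite expr0 mul1r => ->.
by [].
Qed.

Lemma innerDl x y z : inner (x + y) z = inner x z + inner y z.
Proof. exact: linearDl. Qed.

Lemma innerDr x y z : inner z (x + y) = inner z x + inner z y.
Proof. exact: linearDr. Qed.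

Lemma innerNl x z : inner (- x) z = - inner x z.
Proof. exact: linearNl. Qed.

Lemma innerNr x z : inner z (- x) = - inner z x.
Proof. exact: linearNr. Qed.

Lemma innerZl (a : R[i]) x z : inner (a *: x) z = a * inner x z.
Proof. exact: linearZl_LR. Qed.

Lemma innerZr (a : R[i]) x z : inner z (a *: x) = a^*%C * inner z x.
Proof. exact: linearZr_LR. Qed.

Lemma inner0l z : inner 0 z = 0.
Proof. exact: linear0l. Qed.

Lemma inner0r z : inner z 0 = 0.
Proof. exact: linear0r. Qed.

Definition innerE :=
  (innerDl, innerDr, innerNl, innerNr, innerZl, innerZr, inner0l, inner0r).

Lemma ripC x y : rip x y = rip y x.
Proof. by rewrite /rip innerC; case: (inner y x). Qed.

Lemma ripDl x y z : rip (x + y) z = rip x z + rip y z.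
Proof. by rewrite /rip innerDl raddfD. Qed.

Lemma ripDr x y z : rip z (x + y) = rip z x + rip z y.
Proof. by rewrite !(ripC z) ripDl. Qed.

Lemma ripNl x z : rip (- x) z = - rip x z.
Proof. by rewrite /rip innerNl raddfN. Qed.

Lemma ripNr x z : rip z (- x) = - rip z x.
Proof. by rewrite !(ripC z) ripNl. Qed.

Lemma ripZl t x z : rip (t%:C *: x) z = t * rip x z.
Proof.
rewrite /rip innerZl.
by case: (inner x z : R[i]) => a b /=; rewrite mul0r subr0.
Qed.

Lemma ripZr t x z : rip z (t%:C *: x) = t * rip z x.
Proof. by rewrite !(ripC z) ripZl. Qed.

Lemma rip0l z : rip 0 z = 0.
Proof. by rewrite /rip inner0l. Qed.

Lemma rip0r z : rip z 0 = 0.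
Proof. by rewrite ripC rip0l. Qed.

Definition ripE := (ripDl, ripDr, ripNl, ripNr, ripZl, ripZr, rip0l, rip0r).

Lemma nrm_ge0 x : 0 <= nrm x.
Proof. by rewrite -ler0c -normE. Qed.

Lemma nrm_sqr x : nrm x ^+ 2 = rip x x.
Proof.
rewrite /rip (_ : inner x x = `|x| ^+ 2); last exact/esym/sqr_norm_inner.
by rewrite normE -rmorphXn.
Qed.

Lemma nrm0 : nrm (0 : H) = 0.
Proof. by rewrite /nrm normr0. Qed.

Lemma nrm_eq0 x : (nrm x == 0) = (x == 0).
Proof. by rewrite -[x == 0]normr_eq0 normE (inj_eq (@complexI R)). Qed.

Lemma nrm0_eq0 x : nrm x = 0 -> x = 0.
Proof. by move/eqP; rewrite nrm_eq0 => /eqP. Qed.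

Lemma nrm_gt0 x : (0 < nrm x) = (x != 0).
Proof. by rewrite lt_neqAle nrm_ge0 andbT eq_sym nrm_eq0. Qed.

Lemma nrmN x : nrm (- x) = nrm x.
Proof. by rewrite /nrm normrN. Qed.

Lemma nrmB x y : nrm (x - y) = nrm (y - x).
Proof. by rewrite -nrmN opprB. Qed.

Lemma nrmD x y : nrm (x + y) <= nrm x + nrm y.
Proof. by rewrite -lecR rmorphD /= -!normE ler_normD. Qed.

Lemma nrm_triB x y z : nrm (x - z) <= nrm (x - y) + nrm (y - z).
Proof. by rewrite (le_trans _ (nrmD _ _)) // addrA subrK. Qed.

Lemma nrmZ (a : R[i]) x : nrm (a *: x) = complex.Re `|a| * nrm x.
Proof.
apply: (@complexI R); rewrite rmorphM /= -!normE normrZ.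
by congr (_ * _); rewrite RRe_real // ger0_real.
Qed.

Lemma nrmZr t x : nrm (t%:C *: x) = `|t| * nrm x.
Proof.
by rewrite nrmZ normc_def /= expr0n /= addr0 sqrtr_sqr.
Qed.

Lemma sqr_nrmD x y : nrm (x + y) ^+ 2 = nrm x ^+ 2 + 2 * rip x y + nrm y ^+ 2.
Proof. rewrite !nrm_sqr !ripE (ripC y x); ring. Qed.

Lemma sqr_nrmB x y : nrm (x - y) ^+ 2 = nrm x ^+ 2 - 2 * rip x y + nrm y ^+ 2.
Proof. rewrite !nrm_sqr !ripE (ripC y x); ring. Qed.

Lemma rip_le x y : rip x y <= nrm x * nrm y.
Proof.
have [->|y0] := eqVneq y 0; first by rewrite rip0r nrm0 mulr0.
have ny : 0 < nrm y by rewrite nrm_gt0.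
(* Expanding the square gives [2 a b (a b - c) >= 0], with [a], [b], [c] as named below. *)
have : 0 <= nrm ((nrm y)%:C *: x - (nrm x)%:C *: y) ^+ 2 by rewrite sqr_ge0.
rewrite sqr_nrmB !nrmZr !ripE !ger0_norm ?nrm_ge0 //.
have := nrm_ge0 x; rewrite le_eqVlt => /predU1P[/esym/nrm0_eq0 ->|nx].
  by move=> _; rewrite rip0l nrm0 mul0r.
set a := nrm x in nx *; set b := nrm y in ny *; set c := rip x y => h.
have : 0 <= (2 * a * b) * (a * b - c) by apply: le_trans h _; lra.
by rewrite pmulr_rge0 ?subr_ge0 // !mulr_gt0.
Qed.

Lemma rip_abs x y : `|rip x y| <= nrm x * nrm y.
Proof.
by rewrite ler_norml rip_le lerNl -ripNl (le_trans (rip_le _ _)) // nrmN.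
Qed.

Lemma rip_ext x y : (forall z, rip z x = rip z y) -> x = y.
Proof.
move=> h; apply/eqP; rewrite -subr_eq0 -nrm_eq0 -sqrf_eq0 nrm_sqr.
by rewrite {2}/GRing.add /= !ripDr !ripNr h subrr.
Qed.

Lemma le_sqr_nrm x t : 0 <= t -> (nrm x ^+ 2 <= t ^+ 2) = (nrm x <= t).
Proof. by move=> t0; rewrite ler_sqr ?nnegrE ?nrm_ge0. Qed.

(** Completeness of [H], with real tolerances in place of filters. *)
Lemma nrm_cauchy_cvg (u : nat -> H) :
  (forall e : R, 0 < e ->
    exists N, forall m n, (N <= m)%N -> (N <= n)%N -> nrm (u m - u n) < e) ->
  exists l, forall e : R, 0 < e ->
    exists N, forall n, (N <= n)%N -> nrm (u n - l) < e.
Proof.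
move=> cu.
have : cauchy (u @ \oo).
  apply/cauchy_ballP => e e0.
  have [er e0'] : e = (complex.Re e)%:C /\ 0 < complex.Re e.
    have := e0; rewrite ltcE /= => /andP[/eqP ie re]; split=> //.
    by case: e {e0 re} ie => a b /= ->.
  have [N hN] := cu _ e0'.
  exists ([set x | exists2 m, (N <= m)%N & u m = x],
          [set x | exists2 m, (N <= m)%N & u m = x]).
    by split; exists N => // m /= Nm; exists m.
  move=> [_ _] /= [[m Nm <-] [n Nn <-]].
  by rewrite -ball_normE /ball_ /= normE er ltcR hN.
move/cauchy_cvgP => /cvg_ex[l ul]; exists l => e e0.
have /cvgrPdist_lt/(_ e%:C) := ul; rewrite ltcR => /(_ e0) [N _ hN].
by exists N => n Nn; have := hN n Nn; rewrite /= normE ltcR nrmB.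
Qed.

End RealStructure.


(** * Orthogonal projection, finite-dimensional complements, adjoints *)

Section Projection.
Context {R : realType} {H : hilbertType R}.
Implicit Types (x y z : H) (t : R) (C : set H) (f g : {linear H -> H}).

Definition adherent C x :=
  forall e : R, 0 < e -> exists2 y, C y & nrm (x - y) < e.

Definition real_subspace C :=
  C 0 /\ forall t x y, C x -> C y -> C (t%:C *: x + y).

Lemma parallelogram x y :
  nrm (x + y) ^+ 2 + nrm (x - y) ^+ 2 = 2 * nrm x ^+ 2 + 2 * nrm y ^+ 2.
Proof. rewrite sqr_nrmD sqr_nrmB; ring. Qed.

(** At the minimizer [t = rip x y / nrm y ^+ 2] the squared norm drops by
    [rip x y ^+ 2 / nrm y ^+ 2], which must therefore be 0. *)
Lemma nrm_le_rip0 x y : (forall t, nrm x <= nrm (x - t%:C *: y)) -> rip x y = 0.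
Proof.
move=> h; have [->|y0] := eqVneq y 0; first by rewrite rip0r.
have ny : nrm y ^+ 2 != 0 by rewrite expf_eq0 /= nrm_eq0.
have := h (rip x y / nrm y ^+ 2).
rewrite -le_sqr_nrm ?nrm_ge0 // sqr_nrmB nrmZr ripE exprMn real_normK ?num_real //.
set c := rip x y; set b := nrm y ^+ 2 in ny * => h'.
have b0 : 0 < b by rewrite lt_neqAle eq_sym ny sqr_ge0.
have : c ^+ 2 / b <= 0.
  have -> : c ^+ 2 / b = - (- (2 * (c / b * c)) + (c / b) ^+ 2 * b) by field.
  by rewrite oppr_le0; lra.
rewrite pmulr_lle0 ?invr_gt0 // => c2.
by apply/eqP; rewrite -sqrf_eq0 eq_le c2 sqr_ge0.
Qed.

(** A minimizing sequence is Cauchy by the parallelogram law. The sets projected onto later are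
    handled only as real subspaces. *)
Lemma projection C x : real_subspace C -> (forall y, adherent C y -> C y) ->
  exists2 p, C p & forall c, C c -> rip (x - p) c = 0.
Proof.
move=> [C0 CP] Ccl.
pose D := [set nrm (x - c) | c in C].
have D0 : has_inf D.
  by split; [exists (nrm (x - 0)), 0|exists 0 => _ [c _ <-]; exact: nrm_ge0].
pose d := inf D.
have d0 : 0 <= d by apply: lb_le_inf; [exact: D0.1|move=> _ [c _ <-]; exact: nrm_ge0].
have dle c : C c -> d <= nrm (x - c) by move=> Cc; apply: (ge_inf D0.2); exists c.
have /choice[u uP] : forall n : nat,
    exists c, C c /\ nrm (x - c) ^+ 2 < d ^+ 2 + n.+1%:R^-1.
  move=> n; have n0 : (0 : R) < n.+1%:R^-1 by rewrite invr_gt0.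
  have sd : d < Num.sqrt (d ^+ 2 + n.+1%:R^-1).
    rewrite -[ltLHS](ger0_norm d0) -sqrtr_sqr ltr_sqrt; first by rewrite ltrDl.
    by rewrite ltr_wpDl ?sqr_ge0.
  have /(inf_adherent) /(_ D0) [_ [c Cc <-]] : 0 < Num.sqrt (d ^+ 2 + n.+1%:R^-1) - d.
    by rewrite subr_gt0.
  rewrite -/d [d + _]addrC subrK => h; exists c; split => //.
  rewrite -(ltr_sqrt (nrm (x-c) ^+ 2)) ?sqrtr_sqr ?ger0_norm ?nrm_ge0 //.
  by rewrite ltr_wpDl ?sqr_ge0.
have uu m n : nrm (u m - u n) ^+ 2 <= 2 * m.+1%:R^-1 + 2 * n.+1%:R^-1.
  have [Cm um] := uP m; have [Cn un] := uP n.
  have := parallelogram (x - u m) (x - u n).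
  have -> : x - u m - (x - u n) = - (u m - u n).
    by rewrite !opprB addrC addrA subrK.
  (* The midpoint of [u m] and [u n] lies in [C], hence at distance at least [d] from [x]. *)
  have -> : x - u m + (x - u n) = 2%:C *: (x - (2^-1 : R)%:C *: (u m + u n)).
    rewrite scalerBr scalerA -rmorphM mulfV ?pnatr_eq0 // rmorph1 scale1r.
    by rewrite rmorph_nat scaler_nat mulr2n opprD addrACA.
  rewrite nrmN nrmZr exprMn real_normK ?num_real //.
  have : d ^+ 2 <= nrm (x - (2^-1 : R)%:C *: (u m + u n)) ^+ 2.
    rewrite ler_sqr ?nnegrE ?nrm_ge0 //; apply: dle.
    rewrite -[_ *: _]addr0; apply: (CP) => //.
    by rewrite -[u m]scale1r; exact: (CP 1).
  move: um un; set i := m.+1%:R^-1; set j := n.+1%:R^-1; lra.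
have [|p up] := nrm_cauchy_cvg (u := u).
  move=> e e0.
  have [N /ltW hN] : exists N : nat, 4 / e ^+ 2 < N%:R.
    exists (Num.truncn (4 / e ^+ 2)).+1; exact: truncnS_gt.
  exists N => m n Nm Nn; rewrite -(ltr_pXn2r (n := 2)) ?nnegrE ?nrm_ge0 ?(ltW e0) //.
  apply: le_lt_trans (uu m n) _.
  have e2 : 0 < e ^+ 2 by rewrite exprn_gt0.
  have inv k : (N <= k)%N -> k.+1%:R^-1 < e ^+ 2 / 4.
    move=> Nk; rewrite -[ltRHS]invrK ltf_pV2 ?posrE ?invr_gt0 ?divr_gt0 ?ltr0n //.
    by rewrite invf_div (le_lt_trans hN) // ltr_nat.
  have := inv _ Nm; have := inv _ Nn.
  set i := m.+1%:R^-1; set j := n.+1%:R^-1; lra.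
have Cp : C p.
  apply: Ccl => e e0; have [N hN] := up e e0; exists (u N); first exact: (uP N).1.
  by rewrite nrmB hN.
have pd : nrm (x - p) <= d.
  apply/ler_addgt0Pr => e e0.
  pose e' := e / 2; have e'0 : 0 < e' by rewrite divr_gt0.
  have [N1 hN1] := up _ e'0.
  pose M := maxn N1 (Num.truncn (1 / (e' ^+ 2))).
  have : nrm (x - u M) ^+ 2 <= (d + e') ^+ 2.
    apply: le_trans (ltW (uP M).2) _.
    have : M.+1%:R^-1 <= e' ^+ 2.
      rewrite -[leRHS]invrK lef_pV2 ?posrE ?invr_gt0 ?exprn_gt0 //.
      rewrite -div1r; apply: ltW; apply: lt_le_trans (truncnS_gt _) _.
      by rewrite ler_nat ltnS leq_maxr.
    have : 0 <= d * e' by rewrite mulr_ge0 // ltW.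
    set i := M.+1%:R^-1; lra.
  rewrite le_sqr_nrm; last by rewrite addr_ge0 // ltW.
  have := hN1 M (leq_maxl _ _).
  have := nrm_triB x (u M) p; rewrite /e'; lra.
exists p => // c Cc; apply: nrm_le_rip0 => t.
apply: le_trans pd _; rewrite -addrA -opprD; apply: dle.
by rewrite addrC; exact: CP.
Qed.

Definition bounded (M : R) (f : H -> H) := forall x, nrm (f x) <= M * nrm x.

(** The representing vector is a multiple of the component [n] of some [x0] orthogonal to the
    kernel: every [x] differs from a multiple of [n] by a kernel vector. *)
Lemma riesz (phi : H -> R) (M : R) :
  (forall t x y, phi (t%:C *: x + y) = t * phi x + phi y) ->
  (forall x, `|phi x| <= M * nrm x) ->
  exists z, forall x, phi x = rip x z.
Proof.
move=> lin bd.
have phi0 : phi 0 = 0.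
  have := lin 1 0 0; rewrite scaler0 addr0 mul1r; lra.
have [all0|] := pselect (forall x, phi x = 0).
  by exists 0 => x; rewrite rip0r.
move=> /existsNP[x0 /eqP x00].
pose K := [set x | phi x = 0].
have KS : real_subspace K.
  by split=> // t x y /= Kx Ky; rewrite /K /= lin Kx Ky mulr0 addr0.
have phiB x y : phi (x - y) = phi x - phi y.
  have := lin (-1) y x; rewrite rmorphN1 scaleN1r addrC => ->; ring.
have [|p Kp hp] := projection x0 KS.
  move=> y ay; apply/eqP; rewrite -normr_le0; apply/ler_addgt0Pr => e e0.
  have M0 : 0 < `|M| + 1 by rewrite ltr_wpDl.
  have [z Kz yz] := ay (e / (`|M| + 1)) ltac:(by rewrite divr_gt0).
  have -> : phi y = phi (y - z) by rewrite phiB Kz subr0.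
  apply: le_trans (bd _) _; rewrite add0r.
  apply: le_trans (_ : (`|M| + 1) * nrm (y - z) <= _).
    by rewrite ler_wpM2r ?nrm_ge0 // (le_trans (ler_norm _)) // lerDl.
  by rewrite mulrC -ler_pdivlMr // ltW.
pose n := x0 - p.
have phin : phi n = phi x0 by rewrite phiB Kp subr0.
have n0 : nrm n ^+ 2 != 0.
  rewrite sqrf_eq0 nrm_eq0; apply: contra_neq x00 => n0.
  by rewrite -phin n0 phi0.
rewrite -/n in hp; clearbody n.
exists ((phi n / nrm n ^+ 2)%:C *: n) => x.
have : rip n (x - (phi x / phi n)%:C *: n) = 0.
  apply: hp; rewrite /K /= phiB.
  have := lin (phi x / phi n) n 0; rewrite phi0 !addr0 => ->.
  by rewrite mulfVK ?subrr // phin.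
rewrite !ripE -nrm_sqr => /eqP; rewrite subr_eq0 => /eqP h.
rewrite (ripC x) h; field.
by rewrite phin x00 -sqrf_eq0.
Qed.

End Projection.


(** * Orthogonality to finite lists of vectors *)

Section FiniteLists.
Context {R : realType} {H : hilbertType R}.
Implicit Types (x y z w : H) (F : seq H).

Definition orth_seq F x := forall f, f \in F -> inner x f = 0.

Lemma orth_seq_cat F1 F2 x :
  orth_seq (F1 ++ F2) x -> orth_seq F1 x /\ orth_seq F2 x.
Proof.
by move=> h; split=> f fF; apply: h; rewrite mem_cat fF ?orbT.
Qed.

Lemma inner_comb (n : nat) (c : nat -> R[i]) (v : nat -> H) y :
  (forall k, (k < n)%N -> inner y (v k) = 0) ->
  inner y (\sum_(k < n) c k *: v k) = 0.
Proof.
elim: n => [|n IH] h; first by rewrite big_ord0 inner0r.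
rewrite big_ord_recr /= innerDr innerZr h // mulr0 addr0.
by apply: IH => k kn; apply: h; rewrite ltnS ltnW.
Qed.

(** Gram-Schmidt by induction: [x] and the new vector [f] are both decomposed over the tail, and the
    component of [y] along the remainder [g] of [f] is removed. *)
Lemma orth_decomp F x : exists c : nat -> R[i], exists2 y,
  orth_seq F y & x = y + \sum_(k < size F) c k *: F`_k.
Proof.
elim: F x => [|f F IH] x.
  by exists (fun=> 0), x => //; rewrite big_ord0 addr0.
have [c [y yF xE]] := IH x; have [d [g gF fE]] := IH f.
pose t := inner y g / inner g g.
exists (fun k => if k is k'.+1 then c k' - t * d k' else t).
have yg : inner (y - t *: g) g = 0.
  rewrite innerDl innerNl innerZl /t.
  (* If [g = 0], then [f] depends on the tail and division by zero makes [t] vanish. *)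
  have [->|g0] := eqVneq g 0; first by rewrite !inner0r mulr0 subr0.
  rewrite divfK ?subrr // dnorm_eq0 //.
have ygF : orth_seq F (y - t *: g).
  by move=> h hF; rewrite innerDl innerNl innerZl yF // gF // mulr0 subr0.
exists (y - t *: g).
  move=> h; rewrite inE => /predU1P[->|]; last exact: ygF.
  rewrite fE innerDr yg add0r; apply: inner_comb => k kF.
  by apply: ygF; rewrite mem_nth.
rewrite big_ord_recl /= {1}fE xE.
under [in RHS]eq_bigr => k _ do rewrite scalerBl -scalerA.
rewrite sumrB -scaler_sumr scalerDr addrA [_ + (t *: g + _)]addrA subrK.
by rewrite -addrA [t *: _ + _]addrC subrK.
Qed.

Lemma exists_unit_orth F : ~ finite_dimensional H ->
  exists2 x, nrm x = 1 & orth_seq F x.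
Proof.
move=> infH; apply: contrapT => hF; apply: infH; exists F => x.
have [c [y yF xE]] := orth_decomp F x; exists c.
have [y0|y0] := eqVneq y 0; first by rewrite {1}xE y0 add0r.
case: hF; exists ((nrm y)^-1%:C *: y).
  by rewrite nrmZr ger0_norm ?invr_ge0 ?nrm_ge0 // mulVf // nrm_eq0.
by move=> f fF; rewrite innerZl yF // mulr0.
Qed.

(** Adding [f] to the list costs a correction along a single vector [g], unless orthogonality to the
    tail already forces orthogonality to [f]. *)
Lemma real_orth_approx F : exists2 C : R, 0 <= C & forall w, exists2 b,
  (forall f, f \in F -> rip b f = 0) &
  nrm (w - b) <= C * \sum_(f <- F) `|rip w f|.
Proof.
elim: F => [|f F [C C0 IH]].
  by exists 0 => // w; exists w => //; rewrite subrr nrm0 mul0r.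
have [[g gF gf]|hg] := pselect (exists2 g,
  (forall h, h \in F -> rip g h = 0) & rip g f != 0).
  pose K := nrm g / `|rip g f|.
  have K0 : 0 <= K by rewrite divr_ge0 ?nrm_ge0.
  exists (C + K * (1 + C * nrm f)).
    by rewrite addr_ge0 // mulr_ge0 // addr_ge0 // mulr_ge0 // nrm_ge0.
  move=> w; have [b bF wb] := IH w.
  pose t := rip b f / rip g f.
  exists (b - t%:C *: g).
    move=> h; rewrite inE => /predU1P[->|hF].
      by rewrite !ripE /t divfK ?subrr.
    by rewrite !ripE bF // gF // mulr0 subr0.
  rewrite big_cons; set s := \sum_(j <- F) _ in wb *.
  have s0 : 0 <= s by apply: sumr_ge0.
  have bf : `|rip b f| <= `|rip w f| + C * s * nrm f.
    have -> : rip b f = rip w f - rip (w - b) f by rewrite ripDl ripNl; ring.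
    rewrite (le_trans (ler_normB _ _)) // lerD2l (le_trans (rip_abs _ _)) //.
    by rewrite ler_wpM2r ?nrm_ge0.
  have : `|t| * nrm g <= K * (`|rip w f| + C * s * nrm f).
    have -> : `|t| * nrm g = K * `|rip b f| by rewrite /t /K normrM normfV; ring.
    by rewrite ler_wpM2l.
  have : nrm (w - (b - t%:C *: g)) <= nrm (w - b) + `|t| * nrm g.
    by rewrite opprB addrA addrAC -nrmZr nrmD.
  have : 0 <= C * `|rip w f| by rewrite mulr_ge0.
  have : 0 <= K * s by rewrite mulr_ge0.
  have : 0 <= K * C * nrm f * `|rip w f| by rewrite mulr_ge0 // mulr_ge0 ?nrm_ge0 // mulr_ge0.
  move: wb; set a := `|rip w f|; lra.
exists C => // w; have [b bF wb] := IH w; exists b.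
  move=> h; rewrite inE => /predU1P[->|]; last exact: bF.
  by apply/eqP/negP => bf; apply: hg; exists b => //; exact/negP.
by rewrite big_cons (le_trans wb) // ler_wpM2l // lerDr.
Qed.

End FiniteLists.


(** * Bounded operators and their adjoints *)

Section Adjoint.
Context {R : realType} {H : hilbertType R}.
Implicit Types (x y z w : H) (T : {linear H -> H}).

Lemma bounded_operatorP T :
  bounded_operator T -> exists2 M, 0 <= M & bounded M T.
Proof.
move=> /linear_bounded_continuous /linear_boundedP /pinfty_ex_gt0[r r0 hr].
have := r0; rewrite ltcE /= => /andP[/eqP ir rr].
have rE : r = (complex.Re r)%:C by case: (r) ir => a b /= ->.
exists (complex.Re r); first exact: ltW.
by move=> x; have := hr x; rewrite !normE rE -rmorphM lecR.
Qed.

Lemma linearZR T (t : R) x : T (t%:C *: x) = t%:C *: T x.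
Proof. exact: linearZ. Qed.

Lemma linearZC T (a : R[i]) x : T (a *: x) = a *: T x.
Proof. exact: linearZ. Qed.

Lemma opnorm_on_ub (L : set H) (f : H -> H) (M : R) x : 0 <= M ->
  bounded M f -> L x -> nrm x <= 1 -> nrm (f x) <= opnorm_on L f.
Proof.
move=> M0 bf Lx x1; apply: ub_le_sup; last first.
  by exists x => //; split=> //; rewrite normE -(rmorph1 (real_complex R)) lecR.
exists M => _ [y [_ y1] <-]; rewrite -/(nrm _) (le_trans (bf y)) //.
move: y1; rewrite normE -(rmorph1 (real_complex R)) lecR => y1.
by rewrite -[leRHS]mulr1 ler_wpM2l.
Qed.

Lemma opnorm_bounded T (S : {linear H -> H}) (e : R) :
  bounded_operator T -> bounded_operator S -> opnorm (T \- S) < e ->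
  bounded e (T \- S).
Proof.
move=> /bounded_operatorP[M M0 bT] /bounded_operatorP[N N0 bS] he x.
have [->|x0] := eqVneq x 0.
  have -> : (T \- S) 0 = T 0 - S 0 by [].
  by rewrite !raddf0 addr0 nrm0 mulr0.
have nx : 0 < nrm x by rewrite nrm_gt0.
have bTS : bounded (M + N) (T \- S).
  by move=> y; rewrite (le_trans (nrmD _ _)) // nrmN mulrDl lerD.
have := opnorm_on_ub (addr_ge0 M0 N0) bTS (x := (nrm x)^-1%:C *: x) (L := setT) I.
rewrite nrmZr ger0_norm ?invr_ge0 ?nrm_ge0 // mulVf ?gt_eqF // lexx => /(_ isT).
have -> : (T \- S) ((nrm x)^-1%:C *: x) = (nrm x)^-1%:C *: ((T \- S) x).
  by rewrite scalerBr -!linearZR.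
rewrite nrmZr ger0_norm ?invr_ge0 ?nrm_ge0 // => h.
have := le_lt_trans h he.
by rewrite mulrC ltr_pdivrMr // => /ltW.
Qed.

(** Riesz representation of the real part of [inner (T x) y] provides a candidate, and testing it at
    ['i *: u] recovers the imaginary part; so the default value in [adjoint] never occurs. *)
Lemma adjointP T M x y : bounded M T ->
  inner (T x) y = inner x (adjoint T y).
Proof.
move=> bT; rewrite /adjoint; case: xgetP => [z _ ->//|noz]; exfalso.
have [||z hz] := @riesz R H (fun x => rip (T x) y) (M * nrm y).
- by move=> t u v; rewrite linearD linearZR ripDl ripZl.
- move=> u; rewrite (le_trans (rip_abs _ _)) // mulrAC.
  by rewrite ler_wpM2r ?nrm_ge0.
apply: (noz z) => u.
apply/eqP; rewrite eq_complex; apply/andP; split; apply/eqP; first exact: hz.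
have := hz ('i *: u); rewrite /= linearZ /rip /= !innerZl.
by rewrite [_ * inner (T u) y]mulrC [_ * inner u z]mulrC !ReiNIm => /oppr_inj.
Qed.

Lemma inner_ext x y : (forall z, inner z x = inner z y) -> x = y.
Proof. by move=> h; apply: rip_ext => z; rewrite /rip h. Qed.

Lemma linear_adjoint T M : bounded M T ->
  exists Ts : {linear H -> H}, Ts = adjoint T :> (H -> H).
Proof.
move=> bT; have lin : linear (adjoint T).
  move=> a x y; apply: inner_ext => z.
  by rewrite -(adjointP _ _ bT) !innerDr !innerZr !(adjointP _ _ bT).
pose m := GRing.isLinear.Build _ H H _ (adjoint T) lin.
by exists (HB.pack_for {linear H -> H} (adjoint T : H -> H) m).
Qed.

Lemma bounded_adjoint T M : bounded M T -> bounded M (adjoint T).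
Proof.
move=> bT y; have := nrm_ge0 (adjoint T y).
rewrite le_eqVlt => /predU1P[/esym h|h].
  by rewrite h; exact: le_trans (nrm_ge0 _) (bT y).
rewrite -(ler_pM2r h) -expr2 nrm_sqr /rip -(adjointP _ _ bT).
rewrite (le_trans (rip_le _ _)) // mulrAC.
by rewrite ler_wpM2r ?nrm_ge0.
Qed.

End Adjoint.


(** * The essential modulus *)

Section EssentialModulus.
Context {R : realType} {H : hilbertType R}.
Implicit Types (x y z : H) (S T : {linear H -> H}) (F : seq H) (p q c : R).

(** Persistence of small, and below of large, values outside every finite-dimensional subspace; the
    two at separated levels are what norm attainment rules out. *)
Definition ess_low S p := forall F, exists x,
  [/\ nrm x = 1, orth_seq F x & nrm (S x) <= p].

Definition ess_high S q := forall F, exists x,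
  [/\ nrm x = 1, orth_seq F x & q <= nrm (S x)].

(** For bounded [T] and [b >= 0] this amounts to compactness of [T* T - b ^ 2]. Real orthogonality
    is enough, as [F] can be enlarged by its multiples by ['i]. *)
Definition essential_modulus T (b : R) := forall e : R, 0 < e ->
  exists F, forall x, (forall f, f \in F -> rip x f = 0) ->
    `|nrm (T x) - b * nrm x| <= e * nrm x.

Lemma rip_inner0 x y : inner x y = 0 -> rip x y = 0.
Proof. by rewrite /rip => ->. Qed.

Lemma inner0_sym x y : inner x y = 0 -> inner y x = 0.
Proof. by rewrite [inner y x]innerC => ->; rewrite conjc0. Qed.

(** Choosing [y] orthogonal to [x] and to [S* S x] makes [S x] and [S y] orthogonal too, so the
    squared norms of combinations interpolate between the two ends. *)
Lemma ess_intermediate S M p q c F : bounded M S ->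
  ess_low S p -> ess_high S q -> p < c -> c < q ->
  exists x, [/\ nrm x = 1, orth_seq F x & nrm (S x) = c].
Proof.
move=> bS low high pc cq.
have [x [x1 xF xp]] := low F.
have [y [y1 yF yq]] := high ([:: x; adjoint S (S x)] ++ F).
have {yF}[yx yF] := orth_seq_cat yF.
have xy0 : rip x y = 0 by rewrite ripC; apply/rip_inner0/yx; rewrite inE eqxx.
have Sxy0 : rip (S x) (S y) = 0.
  rewrite ripC; apply: rip_inner0; rewrite (adjointP _ _ bS); apply: yx.
  by rewrite !inE eqxx orbT.
move: xp yq; set P := nrm (S x); set Q := nrm (S y) => xp yq.
have P0 : 0 <= P by exact: nrm_ge0.
have PQ : 0 < Q ^+ 2 - P ^+ 2 by rewrite subr_gt0 ltr_sqr ?nnegrE ?nrm_ge0 //; lra.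
have c0 : 0 <= c by lra.
(* [A] and [B] solve [A + B = 1] and [A P ^ 2 + B Q ^ 2 = c ^ 2]. *)
pose A := (Q ^+ 2 - c ^+ 2) / (Q ^+ 2 - P ^+ 2).
pose B := (c ^+ 2 - P ^+ 2) / (Q ^+ 2 - P ^+ 2).
have A0 : 0 <= A.
  by rewrite divr_ge0 // ?(ltW PQ) // subr_ge0 ler_sqr ?nnegrE ?nrm_ge0 //; lra.
have B0 : 0 <= B.
  by rewrite divr_ge0 // ?(ltW PQ) // subr_ge0 ler_sqr ?nnegrE ?nrm_ge0 //; lra.
have sA := sqr_sqrtr A0; have sB := sqr_sqrtr B0.
exists ((Num.sqrt A)%:C *: x + (Num.sqrt B)%:C *: y); split.
- apply/eqP; rewrite -(@eqrXn2 _ 2) ?nrm_ge0 //; apply/eqP.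
  rewrite sqr_nrmD !nrmZr !ripE xy0 x1 y1 !mulr1 !ger0_norm ?sqrtr_ge0 // sA sB.
  rewrite /A /B; field; lra.
- by move=> f fF; rewrite !innerE xF // yF // !mulr0 addr0.
- apply/eqP; rewrite -(@eqrXn2 _ 2) ?nrm_ge0 //; apply/eqP.
  rewrite linearD !linearZR sqr_nrmD !nrmZr !ripE Sxy0 -/P -/Q.
  rewrite !ger0_norm ?sqrtr_ge0 // !exprMn sA sB.
  rewrite /A /B; field; lra.
Qed.

(** * A closed subspace on which the norm is not attained *)

Section NonAttaining.
Variables (S : {linear H -> H}) (M p q : R) (f : nat -> H).
Hypotheses (M0 : 0 <= M) (bS : bounded M S).
Hypotheses (p0 : 0 <= p) (pq : p < q).
(** Strictly increasing to [q]; the shift by 2 keeps all values above [p]. *)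
Let c (n : nat) : R := q - (q - p) / n.+2%:R.
Hypothesis f1 : forall n, nrm (f n) = 1.
Hypothesis fc : forall n, nrm (S (f n)) = c n.
Hypothesis ff : forall i n, (i < n)%N -> inner (f n) (f i) = 0.
Hypothesis Sff : forall i n, (i < n)%N -> inner (S (f n)) (S (f i)) = 0.

Let P n x : H := \sum_(i < n) inner x (f i) *: f i.

Let PS n x : P n.+1 x = P n x + inner x (f n) *: f n.
Proof. by rewrite /P big_ord_recr. Qed.

Let c_lt n : c n < q.
Proof. by rewrite /c ltrBlDr ltrDl divr_gt0 // subr_gt0. Qed.

Let c_ge0 n : 0 <= c n.
Proof. by rewrite -fc nrm_ge0. Qed.

Let P_lin n a x y : P n (a *: x + y) = a *: P n x + P n y.
Proof.
rewrite /P scaler_sumr -big_split; apply: eq_bigr => i _ /=.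
by rewrite innerDl innerZl scalerDl scalerA.
Qed.

Let inner_f i j : inner (f i) (f j) = (i == j)%:R.
Proof.
have [->|] := eqVneq i j.
  have : `|f j| ^+ 2 = inner (f j) (f j) by exact: sqr_norm_inner.
  by rewrite normE f1 => <-; rewrite -rmorphXn expr1n.
by rewrite neq_ltn => /orP[] ij; [apply: inner0_sym|]; apply: ff.
Qed.

Let f_P n x : inner (f n) (P n x) = 0.
Proof.
by apply: (@inner_comb _ _ n (fun i => inner x (f i)) f) => k kn; rewrite ff.
Qed.

Let inner_P n x i : (i < n)%N -> inner (P n x) (f i) = inner x (f i).
Proof.
elim: n => // n IH; rewrite ltnS leq_eqVlt PS innerDl innerZl inner_f => /predU1P[->|ni].
  by rewrite eqxx mulr1 innerC f_P conjc0 add0r.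
by rewrite gtn_eqF // mulr0 addr0 IH.
Qed.

Let pyth x y : inner x y = 0 -> nrm (x + y) ^+ 2 = nrm x ^+ 2 + nrm y ^+ 2.
Proof. by move=> /rip_inner0 h; rewrite sqr_nrmD h mulr0 addr0. Qed.

Let P_le n x : nrm (P n x) <= nrm x.
Proof.
rewrite -(@ler_sqr R) ?nnegrE ?nrm_ge0 // -[x in leRHS](subrK (P n x)) pyth ?lerDr ?sqr_ge0 //.
apply: (@inner_comb _ _ n (fun i => inner x (f i)) f) => i ni.
by rewrite innerDl innerNl inner_P // subrr.
Qed.

Let P_f m n : (m < n)%N -> P n (f m) = f m.
Proof.
move=> mn; rewrite /P (bigD1 (Ordinal mn)) //= inner_f eqxx scale1r big1 ?addr0 // => i.
by rewrite -val_eqE /= eq_sym inner_f => /negPf ->; rewrite scale0r.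
Qed.

Let Q n x := q ^+ 2 * nrm (P n x) ^+ 2 - nrm (S (P n x)) ^+ 2.

Let QS n x : Q n.+1 x =
  Q n x + complex.Re `|inner x (f n)| ^+ 2 * (q ^+ 2 - c n ^+ 2).
Proof.
rewrite /Q PS linearD linearZC !pyth.
- rewrite !nrmZ f1 fc; ring.
- rewrite innerZr; apply/eqP; rewrite mulf_eq0; apply/orP; right; apply/eqP.
  apply: inner0_sym; rewrite /P linear_sum.
  under eq_bigr do rewrite linearZC.
  apply: (@inner_comb _ _ n (fun i => inner x (f i)) (S \o f)) => k kn.
  exact: Sff.
- by rewrite innerZr [inner (P n x) _]innerC f_P conjc0 mulr0.
Qed.

(** The closed span of [f], described by convergence of the orthogonal expansion. *)
Let L := [set x | forall e : R, 0 < e ->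
  exists N, forall n, (N <= n)%N -> nrm (x - P n x) < e].

Lemma nonattaining_closed : closed_subspace L.
Proof.
split.
- move=> x clx e e0; have e3 : 0 < e / 3 by rewrite divr_gt0.
  have e3c : 0 < (e / 3)%:C by rewrite ltcR.
  have [y [Ly]] := clx _ (nbhsx_ballx x _ e3c).
  rewrite -ball_normE /= normE ltcR => xy.
  have [N hN] := Ly _ e3; exists N => n Nn.
  have PB : P n y - P n x = P n (y - x).
    by rewrite addrC -(scaleN1r (P n x)) -P_lin scaleN1r addrC.
  have := hN n Nn; have := P_le n (y - x); rewrite -PB [nrm (y - x)]nrmB.
  have := nrm_triB x y (P n x); have := nrm_triB y (P n y) (P n x); lra.
- move=> e e0; exists 0%N => n _.
  have -> : P n 0 = 0.
    by rewrite /P big1 // => i _; rewrite inner0l scale0r.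
  by rewrite subr0 nrm0.
- move=> a x y Lx Ly e e0.
  pose K := complex.Re `|a| + 1.
  have a0 : 0 <= complex.Re `|a| by rewrite -ler0c RRe_real // ger0_real.
  have K0 : 0 < K by rewrite /K; lra.
  have [|N1 h1] := Lx (e / (2 * K)); first by rewrite divr_gt0 // mulr_gt0.
  have [|N2 h2] := Ly (e / 2); first by rewrite divr_gt0.
  exists (maxn N1 N2) => n; rewrite geq_max => /andP[n1 n2].
  rewrite P_lin opprD addrACA -scalerBr.
  apply: le_lt_trans (nrmD _ _) _; rewrite nrmZ.
  have := h2 n n2; have := h1 n n1; set s := nrm (x - _).
  rewrite ltr_pdivlMr ?mulr_gt0 // /K.
  have : 0 <= s by exact: nrm_ge0.
  set A := complex.Re _ in a0 *; nra.
Qed.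

Lemma nonattaining_f n : L (f n).
Proof.
by move=> e e0; exists n.+1 => m nm; rewrite P_f // subrr nrm0.
Qed.

(* [Q n x] is a nondecreasing sequence tending to [q ^ 2 |x| ^ 2 - |S x| ^ 2],
   and it is eventually positive. *)
Lemma nonattaining_lt x : L x -> nrm x = 1 -> nrm (S x) < q.
Proof.
move=> Lx x1.
have [n0 an0] : exists n0, inner x (f n0) != 0.
  apply: contrapT => h.
  have P0 n : P n x = 0.
    rewrite /P big1 // => i _.
    have [->|nz] := eqVneq (inner x (f i)) 0; first by rewrite scale0r.
    by case: h; exists i.
  have [|N /(_ N (leqnn N))] := Lx 1; first by [].
  by rewrite P0 subr0 x1 ltxx.
have q0 : 0 <= q by exact: le_trans p0 (ltW pq).
pose d := complex.Re `|inner x (f n0)| ^+ 2 * (q ^+ 2 - c n0 ^+ 2).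
have Re0 (z : R[i]) : z != 0 -> 0 < complex.Re `|z|.
  by move=> z0; rewrite -ltcR RRe_real ?normr_gt0 // ger0_real.
have qc n : 0 < q ^+ 2 - c n ^+ 2 by rewrite subr_gt0 ltr_sqr ?nnegrE.
have d0 : 0 < d by rewrite mulr_gt0 // exprn_gt0 // Re0.
have Qmono n : Q n x <= Q n.+1 x.
  by rewrite QS lerDl mulr_ge0 ?sqr_ge0 ?(ltW (qc n)).
have Q0 : Q 0%N x = 0.
  by rewrite /Q /P big_ord0 linear0 nrm0 expr0n /= mulr0 subr0.
have Qge n : d <= Q (n0.+1 + n)%N x.
  elim: n => [|n IH]; last by rewrite addnS (le_trans IH).
  have : 0 <= Q n0 x.
    by elim: (n0) => [|n IH]; rewrite ?Q0 // (le_trans IH).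
  by rewrite addn0 QS -/d lerDr.
have dq : d <= q ^+ 2.
  have := Qge 0%N; rewrite /Q; set a := nrm (P _ x); set b := nrm (S _).
  have a1 : a <= 1 by rewrite -x1; exact: P_le.
  have : q ^+ 2 * a ^+ 2 <= q ^+ 2.
    rewrite -[leRHS]mulr1 ler_wpM2l ?sqr_ge0 //.
    by rewrite -[leRHS](expr1n _ 2) ler_sqr ?nnegrE ?nrm_ge0.
  have := sqr_ge0 b; lra.
(* The gap [d] due to one nonzero coordinate bounds [S (P n x)] by [r] for large [n], and the bound
   passes to [S x]. *)
pose r := Num.sqrt (q ^+ 2 - d).
have rq : r < q.
  rewrite -[ltRHS](ger0_norm q0) -sqrtr_sqr ltr_sqrt; first by lra.
  by rewrite exprn_gt0 //; exact: le_lt_trans p0 pq.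
apply: le_lt_trans rq; apply/ler_addgt0Pr => e e0.
have M1 : 0 < M + 1 by rewrite ltr_wpDl.
have [|N hN] := Lx (e / (M + 1)); first by rewrite divr_gt0.
pose n := (n0.+1 + N)%N.
have {}hN : nrm (x - P n x) < e / (M + 1) by apply: hN; rewrite leq_addl.
have Sr : nrm (S (P n x)) <= r.
  rewrite -[leLHS](ger0_norm (nrm_ge0 _)) -sqrtr_sqr ler_sqrt ?subr_ge0 //.
  have := Qge N; rewrite -/n /Q.
  have : q ^+ 2 * nrm (P n x) ^+ 2 <= q ^+ 2.
    rewrite -[leRHS]mulr1 ler_wpM2l ?sqr_ge0 //.
    by rewrite -[leRHS](expr1n _ 2) ler_sqr ?nnegrE ?nrm_ge0 // -x1 P_le.
  lra.
have : nrm (S x) <= nrm (S (x - P n x)) + nrm (S (P n x)).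
  by rewrite -{1}(subrK (P n x) x) linearD nrmD.
have := bS (x - P n x).
move: hN; rewrite ltr_pdivlMr //.
have := nrm_ge0 (x - P n x); set s := nrm (x - _) => *; lra.
Qed.

(** On [L] the norm of [S] is at least every [c n], hence at least [q], which no unit vector of [L]
    reaches. *)
Lemma nonattaining : ~ absolutely_norm_attaining H S.
Proof.
move=> [_ /(_ L nonattaining_closed)] h.
have L0 : L != [set 0].
  apply/eqP => L0; have := nonattaining_f 0; rewrite L0 => f0.
  by have := f1 0; rewrite f0 nrm0 => /eqP; rewrite eq_sym oner_eq0.
have [x [Lx]] := h L0; rewrite !normE => x1 /complexI Sx.
have x1' : nrm x = 1 by apply: (@complexI R); rewrite x1.
have := nonattaining_lt Lx x1'; rewrite ltNge => /negP; apply.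
rewrite Sx; apply/ler_addgt0Pr => e e0.
have cle n : c n <= opnorm_on L S.
  by rewrite -fc; apply: opnorm_on_ub M0 bS (nonattaining_f n) _; rewrite f1.
pose n := Num.truncn ((q - p) / e).
have : (q - p) / n.+2%:R <= e.
  rewrite ler_pdivrMr ?ltr0n // mulrC -ler_pdivrMr // ltW //.
  by apply: lt_trans (truncnS_gt _) _; rewrite ltr_nat.
have := cle n; rewrite /c; set u := _ / _; lra.
Qed.

End NonAttaining.

Lemma an_ess S p q : absolutely_norm_attaining H S ->
  p < q -> ess_low S p -> ess_high S q -> False.
Proof.
move=> anS pq low high.
have [M M0 bS] := bounded_operatorP anS.1.
have p0 : 0 <= p by have [x [_ _]] := low [::]; exact/le_trans/nrm_ge0.
pose c (n : nat) : R := q - (q - p) / n.+2%:R.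
have cp n : p < c n.
  have : (q - p) / n.+2%:R < q - p.
    by rewrite ltr_pdivrMr ?ltr0n // ltr_pMr ?subr_gt0 // ltr1n.
  by rewrite /c; set u := _ / _; lra.
have cq n : c n < q by rewrite /c ltrBlDr ltrDl divr_gt0 // subr_gt0.
(* Orthogonality to [S* S x] for the earlier [x] makes the images under [S] orthogonal. *)
pose aug (l : seq H) := l ++ map (fun x => adjoint S (S x)) l.
have /choice[pick hpick] : forall ln : seq H * nat, exists x,
    [/\ nrm x = 1, orth_seq (aug ln.1) x & nrm (S x) = c ln.2].
  by move=> [l n]; exact: ess_intermediate bS low high (cp n) (cq n).
pose fix l n := if n is n'.+1 then pick (l n', n') :: l n' else [::].
pose f n := pick (l n, n).
have fl i n : (i < n)%N -> f i \in l n.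
  elim: n => // n IH; rewrite ltnS leq_eqVlt inE => /predU1P[->|/IH ->].
    by rewrite eqxx.
  by rewrite orbT.
apply: (@nonattaining S M p q f) => //.
- by move=> n; have [] := hpick (l n, n).
- by move=> n; have [] := hpick (l n, n).
- move=> i n ni; have [_ /orth_seq_cat[h _] _] := hpick (l n, n).
  exact/h/fl.
- move=> i n ni; have [_ /orth_seq_cat[_ h] _] := hpick (l n, n).
  rewrite (adjointP _ _ bS); apply: h.
  by apply: (map_f (fun x => adjoint S (S x))); exact: fl.
Qed.

(** An approximation of [T] within a quarter of the gap still has separated levels
    [p + e < q - e]. *)
Lemma closure_an_ess T p q : opnorm_closure (absolutely_norm_attaining H) T ->
  p < q -> ess_low T p -> ess_high T q -> False.
Proof.
move=> [bT clT] pq low high; pose e := (q - p) / 4.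
have e0 : 0 < e by rewrite divr_gt0 // subr_gt0.
have [S anS /(opnorm_bounded bT anS.1) TS] := clT e e0.
have TSu x : nrm x = 1 -> nrm (T x - S x) <= e.
  by move=> x1; have := TS x; rewrite x1 mulr1.
apply: (@an_ess S (p + e) (q - e)) => //.
- by rewrite /e; lra.
- move=> F; have [x [x1 xF xp]] := low F; exists x; split => //.
  have := TSu x x1; have := nrm_triB (S x) (T x) 0; rewrite !subr0 nrmB; lra.
- move=> F; have [x [x1 xF xp]] := high F; exists x; split => //.
  have := TSu x x1; have := nrm_triB (T x) (S x) 0; rewrite !subr0; lra.
Qed.

(** [b] is the supremum of the strict lower bounds of [nrm (T x)] over unit vectors orthogonal to
    some finite list. Values at least [b + e] cannot persist, since values at most [b + e / 2]
    do. *)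
Lemma closure_an_modulus T : ~ finite_dimensional H ->
  opnorm_closure (absolutely_norm_attaining H) T ->
  exists b : R, essential_modulus T b.
Proof.
move=> infH clT; have [M M0 bT] := bounded_operatorP clT.1.
pose D := [set p : R | exists F, forall x,
  nrm x = 1 -> orth_seq F x -> p < nrm (T x)].
have notD p : ~ D p -> ess_low T p.
  move=> Dp F; apply: contrapT => h; apply: Dp; exists F => x x1 xF.
  by rewrite ltNge; apply/negP => xp; apply: h; exists x.
have D0 : has_sup D.
  split.
    exists (-1), [::] => x _ _.
    by rewrite (lt_le_trans _ (nrm_ge0 _)) // ltrN10.
  exists M => p [F hF]; have [x x1 xF] := exists_unit_orth F infH.
  by rewrite ltW // (lt_le_trans (hF x x1 xF)) // (le_trans (bT x)) // x1 mulr1.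
exists (sup D) => e e0.
have [p [F1 hF1] ple] := sup_adherent e0 D0.
have /notD low : ~ D (sup D + e / 2).
  by move=> Ds; have := ub_le_sup D0.2 Ds; lra.
have [F2 hF2] : exists F, forall x,
    nrm x = 1 -> orth_seq F x -> nrm (T x) < sup D + e.
  apply: contrapT => h; apply: (closure_an_ess clT _ low (q := sup D + e)); first lra.
  move=> F; apply: contrapT => h'; apply: h; exists F => x x1 xF.
  by rewrite ltNge; apply/negP => xp; apply: h'; exists x.
(* The multiples by ['i] turn real orthogonality to the list into complex orthogonality. *)
exists ((F1 ++ F2) ++ map (fun f => 'i *: f) (F1 ++ F2)) => x xF.
have [->|x0] := eqVneq x 0; first by rewrite linear0 nrm0 !mulr0 subrr normr0.
have nx : 0 < nrm x by rewrite nrm_gt0.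
pose u := (nrm x)^-1%:C *: x.
have u1 : nrm u = 1.
  by rewrite nrmZr ger0_norm ?invr_ge0 ?nrm_ge0 // mulVf // gt_eqF.
have {xF} /orth_seq_cat[o1 o2] : orth_seq (F1 ++ F2) u.
  move=> f fF; rewrite innerZl; apply/eqP; rewrite mulf_eq0; apply/orP; right.
  have r1 : rip x f = 0 by apply: xF; rewrite mem_cat fF.
  have r2 : rip x ('i *: f) = 0.
    by apply: xF; rewrite mem_cat orbC; apply/orP; left; apply: map_f.
  rewrite eq_complex; apply/andP; split; apply/eqP; first exact: r1.
  by move: r2; rewrite /rip innerZr; case: (inner x f : R[i]) => a b /=; lra.
have -> : nrm (T x) = nrm (T u) * nrm x.
  by rewrite linearZR nrmZr ger0_norm ?invr_ge0 ?nrm_ge0 // mulrAC mulVf ?mul1r // gt_eqF.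
rewrite -mulrBl normrM (ger0_norm (nrm_ge0 x)) ler_wpM2r ?nrm_ge0 // ler_distl.
have := hF1 u u1 o1; have := hF2 u u1 o2; lra.
Qed.

End EssentialModulus.


(** * Cluster points of approximate eigenvectors *)

Section Cluster.
Context {R : realType} {H : hilbertType R}.
Implicit Types (x y z v : H) (u w : nat -> H).

Definition vanishes w := forall e : R, 0 < e ->
  exists N, forall n, (N <= n)%N -> nrm (w n) < e.

Definition clusters u v := forall e : R, 0 < e ->
  forall N, exists2 n, (N <= n)%N & nrm (u n - v) < e.

(** One ultrafilter serves all bounded sequences at once, so no successive subsequences are
    extracted. *)
Lemma ultra_bounded_limit (U : set_system nat) (a : nat -> R) (K : R) :
  UltraFilter U -> (forall n, `|a n| <= K) ->
  exists l : R, forall e, 0 < e -> U [set n | `|a n - l| < e].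
Proof.
move=> UU aK.
have UP : ProperFilter U by exact: ultra_proper.
have [|l [_ cl]] := @segment_compact R (- K) K (a @ U) _.
  by apply: (@filterE _ U) => n /=; rewrite in_itv /= -ler_norml.
exists l => e e0.
have [//|UC] := in_ultra_setVsetC [set n | `|a n - l| < e] UU.
have [x [[n /= h <-]]] := cl (a @` ~` [set n | `|a n - l| < e]) _
  (filterS (@preimage_image _ _ a _) UC) (nbhsx_ballx l e e0).
by rewrite -ball_normE /= distrC.
Qed.

Lemma filter_seq (T : eqType) (U : set_system nat) (P : T -> nat -> Prop)
    (s : seq T) :
  Filter U -> (forall f, U [set n | P f n]) ->
  U [set n | forall f, f \in s -> P f n].
Proof.
move=> FU UP; elim: s => [|f s IH].
  by apply: (filterS (P := setT)); [move=> n _ f | exact: filterT].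
apply: filterS (filterI (UP f) IH) => n [Pf Ps] g.
by rewrite inE => /predU1P[->//|]; exact: Ps.
Qed.

(** For [m] and [n] in a common [A d], the difference [u m - u n] is almost orthogonal to [F] and
    almost annihilated by [Ts T - rho ^ 2]. The latter is bounded below on the complement of [F]
    because [rho != b], so the difference is small. *)
Lemma modulus_cluster (T Ts : {linear H -> H}) (M b rho : R) u :
  0 <= M -> bounded M T -> bounded M Ts ->
  (forall x y, rip (T x) y = rip x (Ts y)) ->
  essential_modulus T b ->
  0 <= rho -> rho != b -> (forall n, nrm (u n) = 1) ->
  vanishes (fun n => Ts (T (u n)) - (rho ^+ 2)%:C *: u n) ->
  exists v, clusters u v.
Proof.
move=> M0 bT bTs adj modT rho0 rhob u1 van.
pose c := `|rho - b| / 2.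
have c0 : 0 < c by rewrite divr_gt0 // normr_gt0 subr_eq0.
have [F hF] := modT _ c0.
have [C C0 hC] := real_orth_approx F.
have [U [UU Uoo]] := @ultraFilterLemma nat \oo _.
have PU : ProperFilter U by exact: ultra_proper.
have /choice[l hl] : forall f, exists l : R, forall e, 0 < e ->
    U [set n | `|rip (u n) f - l| < e].
  move=> f; apply: (ultra_bounded_limit (K := nrm f)) => n.
  by rewrite (le_trans (rip_abs _ _)) // u1 mul1r.
pose A (d : R) : set nat := [set n | (forall f, f \in F -> `|rip (u n) f - l f| < d)
  /\ nrm (Ts (T (u n)) - (rho ^+ 2)%:C *: u n) < d].
have UA d : 0 < d -> U (A d).
  move=> d0; apply: filterI; first by apply: filter_seq => f; exact: hl.
  by apply: Uoo; have [N hN] := van d d0; exists N.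
pose k : R := (size F)%:R.
have k0 : 0 <= k by exact: ler0n.
(* [K1 * d] will bound the distance from [u m - u n] to its approximation [y] in the complement of
   [F], and [K2 * d] the image of [y] under [Ts T - rho ^ 2]. *)
pose K1 := 2 * (C * k).
have K10 : 0 <= K1 by rewrite mulr_ge0 // mulr_ge0.
pose K2 := 2 + (M ^+ 2 + rho ^+ 2) * K1.
have K20 : 0 <= K2 by rewrite addr_ge0 // mulr_ge0 // addr_ge0 // sqr_ge0.
pose K := K1 + K2 / c ^+ 2.
have K0 : 0 <= K by rewrite addr_ge0 // divr_ge0 // sqr_ge0.
have key d m n : 0 < d -> A d m -> A d n -> nrm (u m - u n) <= K * d.
  move=> d0 [hm vm] [hn vn]; set w := u m - u n.
  have [y yF wy] := hC w.
  have {}wy : nrm (w - y) <= K1 * d.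
    apply: (le_trans wy).
    have : \sum_(f <- F) `|rip w f| <= \sum_(f <- F) (2 * d).
      rewrite big_seq [leRHS]big_seq; apply: ler_sum => f fF.
      have -> : rip w f = (rip (u m) f - l f) - (rip (u n) f - l f).
        by rewrite /w ripDl ripNl; ring.
      rewrite (le_trans (ler_normB _ _)) //; have := hm f fF; have := hn f fF; lra.
    rewrite big_const_seq count_predT iter_addr_0 -mulr_natl -/k => h.
    have := ler_wpM2l C0 h; rewrite /K1; lra.
  pose G x := Ts (T x) - (rho ^+ 2)%:C *: x.
  have GB x z : G (x - z) = G x - G z.
    rewrite /G 2!linearB scalerBr !opprB addrACA [RHS]addrACA.
    by congr (_ + _); exact: addrC.
  have Gw : nrm (G w) <= 2 * d.
    rewrite GB (le_trans (nrmD _ _)) // nrmN.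
    have := ltW vm; have := ltW vn; rewrite -!/(G _); lra.
  have Gd : nrm (G (w - y)) <= (M ^+ 2 + rho ^+ 2) * nrm (w - y).
    rewrite (le_trans (nrmD _ _)) // nrmN nrmZr ger0_norm ?sqr_ge0 // mulrDl lerD2r.
    by rewrite (le_trans (bTs _)) // expr2 -mulrA ler_wpM2l.
  have Gy : nrm (G y) <= K2 * d.
    have -> : G y = G w - G (w - y) by rewrite GB subKr.
    rewrite (le_trans (nrmD _ _)) // nrmN /K2 mulrDl lerD // (le_trans Gd) //.
    by rewrite -mulrA ler_wpM2l // addr_ge0 // sqr_ge0.
  have y0 := nrm_ge0 y; have Ty0 := nrm_ge0 (T y).
  (* On the complement of [F], [T] has modulus close to [b], hence away from
     [rho], whereas [y] is almost annihilated by [Ts T - rho ^ 2]. *)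
  have low : c ^+ 2 * nrm y ^+ 2 <= `|nrm (T y) ^+ 2 - rho ^+ 2 * nrm y ^+ 2|.
    have h1 : c * nrm y <= `|nrm (T y) - rho * nrm y|.
      have := hF y yF.
      have : `|(rho - b) * nrm y| = 2 * (c * nrm y).
        by rewrite normrM (ger0_norm y0) /c; field.
      have -> : (rho - b) * nrm y =
        (nrm (T y) - b * nrm y) - (nrm (T y) - rho * nrm y) by ring.
      have := ler_normB (nrm (T y) - b * nrm y) (nrm (T y) - rho * nrm y).
      lra.
    have h2 : `|nrm (T y) - rho * nrm y| <= nrm (T y) + rho * nrm y.
      rewrite (le_trans (ler_normB _ _)) // !ger0_norm //; exact: mulr_ge0.
    have -> : nrm (T y) ^+ 2 - rho ^+ 2 * nrm y ^+ 2 =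
      (nrm (T y) - rho * nrm y) * (nrm (T y) + rho * nrm y) by ring.
    have cy0 : 0 <= c * nrm y by rewrite mulr_ge0 // ltW.
    rewrite normrM -exprMn expr2; apply: ler_pM => //.
    by rewrite (le_trans h1) // (le_trans h2) // ler_norm.
  have up : `|nrm (T y) ^+ 2 - rho ^+ 2 * nrm y ^+ 2| <= K2 * d * nrm y.
    have -> : nrm (T y) ^+ 2 - rho ^+ 2 * nrm y ^+ 2 = rip y (G y).
      by rewrite /G ripDr ripNr ripZr -adj !nrm_sqr.
    by rewrite (le_trans (rip_abs _ _)) // mulrC ler_wpM2r.
  have yb : nrm y <= K2 / c ^+ 2 * d.
    have [->|yn0] := eqVneq (nrm y) 0.
      by rewrite mulr_ge0 ?(ltW d0) // divr_ge0 // sqr_ge0.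
    have ypos : 0 < nrm y by rewrite lt_neqAle eq_sym yn0.
    have := le_trans low up; rewrite [nrm y ^+ 2]expr2 mulrA ler_pM2r // => h.
    by rewrite mulrAC ler_pdivlMr ?exprn_gt0 // mulrC.
  have := nrmD (w - y) y; rewrite subrK /K mulrDl; lra.
(* Requiring [j <= s j] makes the limit of [u \o s] a cluster point of [u]. *)
have /choice[s hs] : forall j : nat, exists n, (j <= n)%N /\ A j.+1%:R^-1 n.
  move=> j.
  have UB : U (A j.+1%:R^-1 `&` [set n | (j <= n)%N]).
    by apply: filterI; [apply: UA; rewrite invr_gt0|apply: Uoo; exists j].
  have [n [An jn]] := filter_ex UB.
  by exists n.
have [|v hv] := nrm_cauchy_cvg (u := u \o s).
  move=> e e0; pose N := Num.truncn ((K + 1) / e).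
  have d0 : (0 : R) < N.+1%:R^-1 by rewrite invr_gt0.
  have mono j n : (N <= j)%N -> A j.+1%:R^-1 n -> A N.+1%:R^-1 n.
    move=> Nj [h1 h2].
    have le : j.+1%:R^-1 <= N.+1%:R^-1 :> R.
      by rewrite lef_pV2 ?posrE ?ltr0n // ler_nat.
    by split=> [f fF|]; [apply: lt_le_trans (h1 f fF) le|apply: lt_le_trans h2 le].
  exists N => i j Ni Nj /=.
  apply: le_lt_trans (key _ _ _ d0 (mono _ _ Ni (hs i).2) (mono _ _ Nj (hs j).2)) _.
  rewrite ltr_pdivrMr ?ltr0n // mulrC -ltr_pdivrMr //.
  apply: lt_trans (truncnS_gt _).
  by rewrite ltr_pM2r ?invr_gt0 // ltrDl.
exists v => e e0 N; have [N1 hN1] := hv e e0.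
exists (s (maxn N N1)); last by apply: hN1; rewrite leq_maxr.
by rewrite (leq_trans _ (hs _).1) // leq_maxl.
Qed.

End Cluster.


(** * The normal part of an operator *)

Section NormalPart.
Context {R : realType} {H : hilbertType R}.
Implicit Types (x y z v : H) (u w : nat -> H) (A B : {linear H -> H}).
Implicit Types (C : set H).

Definition jointly_normal A B C := forall y, C y ->
  [/\ C (A y), C (B y) & A (B y) = B (A y)].

(* The union of all jointly normal sets is itself jointly normal, hence the
   largest one; for [B] the adjoint of [A] it is the largest reducing subspace
   on which [A] is normal. *)
Definition normal_part A B : set H :=
  [set x | exists2 C, C x & jointly_normal A B C].

Lemma jointly_normal_sym A B C : jointly_normal A B C -> jointly_normal B A C.
Proof. by move=> h y /h[]. Qed.

Lemma normal_partP A B : jointly_normal A B (normal_part A B).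
Proof.
by move=> x [C Cx hC]; have [CA CB AB] := hC x Cx; split=> //; exists C.
Qed.

Lemma normal_part_subspace A B : real_subspace (normal_part A B).
Proof.
split.
  by exists [set 0] => // y ->; rewrite !linear0.
move=> t x y Nx Ny.
exists [set z | exists x y,
  [/\ normal_part A B x, normal_part A B y & z = t%:C *: x + y]].
  by exists x, y.
move=> _ [{Nx}x [{Ny}y [Nx Ny ->]]].
have [NAx NBx ABx] := normal_partP Nx; have [NAy NBy ABy] := normal_partP Ny.
split.
- by exists (A x), (A y); split => //; rewrite linearD linearZR.
- by exists (B x), (B y); split => //; rewrite linearD linearZR.
- by rewrite !(linearD, linearZR) ABx ABy.
Qed.

Lemma bounded_adherent A M C y : 0 <= M -> bounded M A ->
  (forall c, C c -> C (A c)) -> adherent C y -> adherent C (A y).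
Proof.
move=> M0 bA CA ay e e0.
have [|c Cc yc] := ay (e / (M + 1)); first by rewrite divr_gt0 // ltr_wpDl.
exists (A c); first exact: CA.
rewrite -linearB; apply: le_lt_trans (bA _) _.
move: yc; rewrite ltr_pdivlMr ?ltr_wpDl //; have := nrm_ge0 (y - c); lra.
Qed.

Lemma nrm_small x : (forall e : R, 0 < e -> nrm x <= e) -> x = 0.
Proof.
move=> h; apply: nrm0_eq0; apply/eqP; rewrite eq_le nrm_ge0 andbT.
by apply/ler_addgt0Pr => e e0; rewrite add0r h.
Qed.

(** By continuity the closure of the normal part is again jointly normal. *)
Lemma normal_part_closed A B M y : 0 <= M -> bounded M A -> bounded M B ->
  adherent (normal_part A B) y -> normal_part A B y.
Proof.
move=> M0 bA bB ay; exists (adherent (normal_part A B)) => // {ay} z az; split.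
- by apply: (bounded_adherent M0 bA _ az) => c /normal_partP[].
- by apply: (bounded_adherent M0 bB _ az) => c /normal_partP[].
apply/eqP; rewrite -subr_eq0; apply/eqP; apply: nrm_small => e e0.
have K0 : 0 < 2 * M ^+ 2 + 1 by have := sqr_ge0 M; lra.
have [|c Nc zc] := az (e / (2 * M ^+ 2 + 1)); first by rewrite divr_gt0.
have [_ _ ABc] := normal_partP Nc.
have -> : A (B z) - B (A z) = A (B (z - c)) - B (A (z - c)).
  rewrite (linearB B z) (linearB A z) (linearB A (B z)) (linearB B (A z)) ABc.
  by rewrite opprB addrA subrK.
have bAB : nrm (A (B (z - c))) <= M * (M * nrm (z - c)).
  by rewrite (le_trans (bA _)) // ler_wpM2l.
have bBA : nrm (B (A (z - c))) <= M * (M * nrm (z - c)).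
  by rewrite (le_trans (bB _)) // ler_wpM2l.
move: zc; rewrite ltr_pdivlMr //.
have := nrmD (A (B (z - c))) (- B (A (z - c))); rewrite nrmN.
have := nrm_ge0 (z - c); lra.
Qed.

Lemma clusters_shift u v : clusters (fun n => u n.+1) v <-> clusters u v.
Proof.
split=> cv e e0 N.
  by have [n Nn uv] := cv e e0 N; exists n.+1 => //; exact: leqW.
by have [[//|n] Nn uv] := cv e e0 N.+1; exists n.
Qed.

Lemma clusters_image A M u w v (rho : R) : 0 <= M -> bounded M A -> 0 < rho ->
  vanishes (fun n => A (u n) - rho%:C *: w n) ->
  clusters u v -> clusters w (rho^-1%:C *: A v).
Proof.
move=> M0 bA rho0 vA cv e e0 N.
have M1 : 0 < M + 1 by rewrite ltr_wpDl.
have re : 0 < rho * e / 2 by rewrite divr_gt0 // mulr_gt0.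
have [N1 h1] := vA _ re.
have [|n nN nv] := cv (rho * e / 2 / (M + 1)) _ (maxn N N1).
  by rewrite divr_gt0.
move: nN; rewrite geq_max => /andP[nN /h1 {}h1].
exists n => //.
rewrite -(ltr_pM2l rho0) -{1}(ger0_norm (ltW rho0)) -nrmZr scalerBr scalerA.
rewrite -rmorphM mulfV ?gt_eqF // rmorph1 scale1r nrmB.
have := nrm_triB (A v) (A (u n)) (rho%:C *: w n).
rewrite -linearB; have := bA (v - u n); rewrite [nrm (v - _)]nrmB.
by move: nv; rewrite ltr_pdivlMr //; have := nrm_ge0 (u n - v); lra.
Qed.

(** Going forth by [A] and back by [B] multiplies [u n] by [rho ^ 2] up to a vanishing error, and
    this becomes exact at a cluster point. *)
Lemma clusters_comp A B M u w v (rho : R) :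
  0 <= M -> bounded M A -> bounded M B -> 0 < rho ->
  vanishes (fun n => A (u n) - rho%:C *: w n) ->
  vanishes (fun n => B (w n) - rho%:C *: u n) ->
  clusters u v -> B (A v) = (rho ^+ 2)%:C *: v.
Proof.
move=> M0 bA bB rho0 vA vB cv.
apply/eqP; rewrite -subr_eq0; apply/eqP; apply: nrm_small => e e0.
(* [K] exceeds the sum of the coefficients of the four error terms below. *)
pose K := M ^+ 2 + M + rho + rho ^+ 2 + 1.
have K0 : 0 < K by rewrite /K; have := sqr_ge0 M; have := sqr_ge0 rho; lra.
have eK : 0 < e / K by rewrite divr_gt0.
have [N1 h1] := vA _ eK; have [N2 h2] := vB _ eK.
have [n] := cv _ eK (maxn N1 N2).
rewrite geq_max => /andP[/h1{}h1 /h2{}h2] nv.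
set p := A (u n) - _ in h1; set q := B (w n) - _ in h2.
have -> : B (A v) - (rho ^+ 2)%:C *: v =
    B (A (v - u n)) + (B p + (rho%:C *: q + (rho ^+ 2)%:C *: (u n - v))).
  rewrite (linearB A v) (linearB B (A v)) (linearB B (A (u n))) (linearZR B).
  by rewrite 2!scalerBr scalerA -rmorphM -expr2 !subrKA.
rewrite (le_trans (nrmD _ _)) //.
have := nrmD (B p) (rho%:C *: q + (rho ^+ 2)%:C *: (u n - v)).
have := nrmD (rho%:C *: q) ((rho ^+ 2)%:C *: (u n - v)).
rewrite !nrmZr (ger0_norm (ltW rho0)) (ger0_norm (sqr_ge0 rho)).
have := le_trans (bB _) (ler_wpM2l M0 (bA (v - u n))).
rewrite [nrm (v - _)]nrmB; have := bB p.
have := ler_wpM2l (ltW rho0) (ltW h2); have := ler_wpM2l M0 (ltW h1).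
have := ler_wpM2l (sqr_ge0 M) (ltW nv).
have := ler_wpM2l (sqr_ge0 rho) (ltW nv).
have : e = K * (e / K) by field; rewrite gt_eqF.
by rewrite /K; set d := e / _; move: eK; rewrite -/d; lra.
Qed.

(* If [u] is asymptotically shifted forward by [A / rho] and backward by
   [B / rho], then the set of its cluster points is invariant under both, and
   the two maps are inverse to each other there. *)
Lemma cluster_normal_part A B M u v (rho : R) :
  0 <= M -> bounded M A -> bounded M B -> 0 < rho ->
  vanishes (fun n => A (u n) - rho%:C *: u n.+1) ->
  vanishes (fun n => B (u n.+1) - rho%:C *: u n) ->
  clusters u v -> normal_part A B v.
Proof.
move=> M0 bA bB rho0 vA vB cv.
(* Real multiples are included because [A] and [B] map a cluster point to [rho] times a cluster
   point. *)
exists [set z | exists2 t : R, True & exists2 y, clusters u y & z = t%:C *: y].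
  by exists 1 => //; exists v => //; rewrite scale1r.
move=> _ [t _ [y cy ->]]; have cy' := (clusters_shift u y).2 cy; split.
- exists (t * rho) => //; exists (rho^-1%:C *: A y).
    by apply: (clusters_shift _ _).1; exact: (clusters_image M0 bA rho0 vA cy).
  by rewrite linearZR scalerA -rmorphM mulfK // gt_eqF.
- exists (t * rho) => //; exists (rho^-1%:C *: B y).
    exact: (clusters_image M0 bB rho0 vB cy').
  by rewrite linearZR scalerA -rmorphM mulfK // gt_eqF.
- rewrite !linearZR (clusters_comp M0 bA bB rho0 vA vB cy).
  by rewrite (clusters_comp M0 bB bA rho0 vB vA cy').
Qed.

End NormalPart.

(** * Convergence from weighted sums of consecutive terms *)

Section Recursion.
Context {R : realType}.
Implicit Types (a ep e : nat -> R).

(** Each use of the recursion halves the contribution of [B], giving [a n <= e / 2 + B / 2 ^ j] for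
    [n >= N + j]. As [s n] may lie ahead of [n], recursions in both directions are covered. *)
Lemma halving_cvg0 a ep (B : R) (s : nat -> nat) : (forall n, 0 <= a n <= B) ->
  (forall n, n <= s n)%N -> (forall n, a n.+1 <= (ep n + a (s n)) / 2) ->
  ep n @[n --> \oo] --> 0 -> a n @[n --> \oo] --> 0.
Proof.
move=> aB ns rec ep0.
have [B0 aB0] : 0 <= B /\ forall n, a n <= B.
  split=> [|n]; last by case/andP: (aB n).
  by have /andP[h1 h2] := aB 0; exact: le_trans h2.
apply/cvgrPdist_le => e e0.
have e2 : 0 < e / 2 by rewrite divr_gt0.
have /cvgrPdist_le/(_ _ e2)[N _ hN] := ep0.
have key j : forall n, (N + j <= n)%N -> a n <= e / 2 + B / 2 ^+ j.
  elim: j => [|j IH] n Nn.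
    by rewrite expr0 divr1 (le_trans (aB0 n)) // lerDr ltW.
  case: n Nn => [|n]; first by rewrite addnS.
  rewrite addnS ltnS => Nn; apply: le_trans (rec n) _.
  have := IH _ (leq_trans Nn (ns n)).
  have := hN n (leq_trans (leq_addr _ _) Nn).
  rewrite sub0r normrN ler_norml => /andP[_].
  by rewrite exprS invfM; set t := _ ^- j; lra.
pose j := Num.truncn (B / (e / 2)).
exists (N + j.+1)%N => // n /= Nn; rewrite sub0r normrN ger0_norm; last first.
  by case/andP: (aB n).
apply: le_trans (key j.+1 n Nn) _.
have : B / 2 ^+ j.+1 <= e / 2.
  rewrite ler_pdivrMr ?exprn_gt0 // mulrC -ler_pdivrMr // ltW //.
  apply: lt_le_trans (truncnS_gt _) _; rewrite -natrX ler_nat.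
  exact/ltnW/ltn_expl.
lra.
Qed.

Let cvg_dist e (l : R) : (e n @[n --> \oo] --> l) <->
  (`|e n - l| @[n --> \oo] --> 0).
Proof.
split=> /cvgrPdist_le h; apply/cvgrPdist_le => d d0;
  have [N _ hN] := h d d0; exists N => // n /hN /=.
  by rewrite sub0r normrN normr_id distrC.
by rewrite sub0r normrN normr_id distrC.
Qed.

Let dist_bound e (B l : R) : (forall n, `|e n| <= B) ->
  forall n, 0 <= `|e n - l / 3| <= B + `|l / 3|.
Proof.
by move=> eB n; rewrite normr_ge0 (le_trans (ler_normB _ _)) // lerD2r.
Qed.

(** From [2 (e n - l / 3) = (2 e n + e (n + 1) - l) - (e (n + 1) - l / 3)], each distance to [l / 3]
    is at most half of an error plus the next distance. *)
Lemma cvg_of_weighted_fwd e (B l : R) : (forall n, `|e n| <= B) ->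
  2 * e n + e n.+1 @[n --> \oo] --> l -> e n @[n --> \oo] --> l / 3.
Proof.
move=> eB /cvg_dist cl; apply/cvg_dist.
rewrite -cvg_shiftS /= in cl.
apply: (halving_cvg0 (dist_bound l eB) (s := fun n => n.+2)) cl => n.
  exact/leqW/leqnSn.
have := ler_normB (2 * e n.+1 + e n.+2 - l) (e n.+2 - l / 3).
rewrite (_ : _ - _ - _ = 2 * (e n.+1 - l / 3)); last by field.
by rewrite normrM (ger0_norm (ler0n _ 2)); lra.
Qed.

Lemma cvg_of_weighted_bwd e (B l : R) : (forall n, `|e n| <= B) ->
  2 * e n.+1 + e n @[n --> \oo] --> l -> e n @[n --> \oo] --> l / 3.
Proof.
move=> eB /cvg_dist cl; apply/cvg_dist.
apply: (halving_cvg0 (dist_bound l eB) (s := id)) cl => // n.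
have := ler_normB (2 * e n.+1 + e n - l) (e n - l / 3).
rewrite (_ : _ - _ - _ = 2 * (e n.+1 - l / 3)); last by field.
by rewrite normrM (ger0_norm (ler0n _ 2)); lra.
Qed.

End Recursion.


(** * Calculus of vanishing sequences *)

Section Vanishing.
Context {R : realType} {H : hilbertType R}.
Implicit Types (w : nat -> H) (a : nat -> R).

Lemma vanishesP w : vanishes w <-> (nrm (w n) @[n --> \oo] --> (0 : R)).
Proof.
split=> [vw|/cvgrPdist_lt vw].
  apply/cvgrPdist_lt => e e0; have [N hN] := vw e e0; exists N => // n /hN.
  by rewrite sub0r normrN ger0_norm ?nrm_ge0.
move=> e e0; have [N _ hN] := vw e e0; exists N => n /hN /=.
by rewrite sub0r normrN ger0_norm ?nrm_ge0.
Qed.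

Lemma vanishes_le w a : (forall n, nrm (w n) <= a n) ->
  a n @[n --> \oo] --> (0 : R) -> vanishes w.
Proof.
move=> wa /cvgrPdist_lt ca e e0; have [N _ hN] := ca e e0.
exists N => n /hN /=; rewrite sub0r normrN => h.
exact: le_lt_trans (le_trans (wa n) (ler_norm _)) h.
Qed.

Lemma vanishes_sqr w a : (forall n, nrm (w n) ^+ 2 <= a n) ->
  a n @[n --> \oo] --> (0 : R) -> vanishes w.
Proof.
move=> wa /cvgrPdist_lt ca e e0; have [N _ hN] := ca _ (exprn_gt0 2 e0).
exists N => n /hN /=; rewrite sub0r normrN => h.
rewrite -(ltr_pXn2r (n := 2)) ?nnegrE ?nrm_ge0 ?(ltW e0) //.
exact: le_lt_trans (le_trans (wa n) (ler_norm _)) h.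
Qed.

Lemma vanishesD w1 w2 : vanishes w1 -> vanishes w2 ->
  vanishes (fun n => w1 n + w2 n).
Proof.
move=> /vanishesP h1 /vanishesP h2.
apply: (vanishes_le (a := fun n => nrm (w1 n) + nrm (w2 n))).
  by move=> n; exact: nrmD.
by rewrite -[0 in X in _ --> X]addr0; exact: cvgD.
Qed.

Lemma vanishes_bounded (A : H -> H) M w : bounded M A -> vanishes w ->
  vanishes (fun n => A (w n)).
Proof.
move=> bA /vanishesP h; apply: (vanishes_le (a := fun n => M * nrm (w n))) => //.
by rewrite -[0 in X in _ --> X](mulr0 M); apply: cvgM => //; exact: cvg_cst.
Qed.

Lemma vanishesZ (t : R) w : vanishes w -> vanishes (fun n => t%:C *: w n).
Proof.
by apply: (vanishes_bounded (M := `|t|)) => x; rewrite nrmZr.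
Qed.

Lemma vanishes_ext w1 w2 :
  (forall n, w1 n = w2 n) -> vanishes w1 -> vanishes w2.
Proof. by move=> h; have -> : w1 = w2 by exact/funext. Qed.

Lemma vanishes_S w : vanishes (fun n => w n.+1) -> vanishes w.
Proof.
move=> h e e0; have [N hN] := h e e0; exists N.+1 => -[//|n].
by rewrite ltnS; exact: hN.
Qed.

End Vanishing.

(** * Orbits of star-paranormal operators *)

Section StarParanormal.
Context {R : realType} {H : hilbertType R}.
Variables (T Ts : {linear H -> H}) (M b : R).
Implicit Types (x y z v : H) (u : nat -> H).
Hypotheses (M0 : 0 <= M) (bT : bounded M T) (bTs : bounded M Ts).
Hypothesis adj : forall x y, rip (T x) y = rip x (Ts y).
Hypothesis modT : essential_modulus T b.
Hypothesis par : forall x, nrm (Ts x) ^+ 2 <= nrm (T (T x)) * nrm x.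
Hypothesis ker : forall x, T x = 0 <-> Ts x = 0.

Definition nonnormal_part : set H :=
  [set x | forall y, normal_part T Ts y -> rip x y = 0].
Local Notation H1 := nonnormal_part.

Let H1_T x : H1 x -> H1 (T x).
Proof. by move=> hx y /normal_partP[_ hy _]; rewrite adj hx. Qed.

Let H1_Ts x : H1 x -> H1 (Ts x).
Proof. by move=> hx y /normal_partP[hy _ _]; rewrite ripC -adj ripC hx. Qed.

Let H1_lin (t : R) x y : H1 x -> H1 y -> H1 (t%:C *: x + y).
Proof. by move=> hx hy z hz; rewrite !ripE hx // hy // mulr0 addr0. Qed.

Let H1_0 : H1 0. Proof. by move=> z _; rewrite rip0l. Qed.

Let H1_Z (t : R) x : H1 x -> H1 (t%:C *: x).
Proof. by move=> hx; rewrite -[_ *: _]addr0; exact: H1_lin. Qed.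

Let H1_D x y : H1 x -> H1 y -> H1 (x + y).
Proof. by move=> hx hy z hz; rewrite !ripE hx // hy // addr0. Qed.

Let H1_N x : H1 x -> H1 (- x).
Proof. by move=> hx z hz; rewrite !ripE hx // oppr0. Qed.

Let H1_closed x : adherent H1 x -> H1 x.
Proof.
move=> ax y Ny; apply/eqP; rewrite -normr_le0; apply/ler_addgt0Pr => e e0.
have n0 := nrm_ge0 y.
have [|c Hc xc] := ax (e / (nrm y + 1)); first by rewrite divr_gt0 // ltr_wpDl.
have -> : rip x y = rip (x - c) y by rewrite !ripE (Hc y Ny) subr0.
rewrite add0r (le_trans (rip_abs _ _)) //.
move: xc; rewrite ltr_pdivlMr ?ltr_wpDl //; have := nrm_ge0 (x - c); lra.
Qed.

Let H1_normal x : H1 x -> normal_part T Ts x -> x = 0.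
Proof.
by move=> hx Nx; apply/eqP; rewrite -nrm_eq0 -sqrf_eq0 nrm_sqr hx.
Qed.

(** By [ker], the kernel of [T] is jointly normal, so it meets [H1] only in 0. *)
Let T_inj x : H1 x -> T x = 0 -> x = 0.
Proof.
move=> hx Tx; apply: H1_normal => //.
exists [set y | T y = 0] => // y /= Ty; have Tsy := (ker y).1 Ty.
by rewrite Ty Tsy !linear0.
Qed.

Let T_neq0 x : H1 x -> x != 0 -> T x != 0.
Proof. by move=> hx; apply: contra_neq; exact: T_inj. Qed.

(** * The gain along an orbit *)

Definition gain y := nrm (T y) / nrm y.

Let gain_gt0 y : H1 y -> y != 0 -> 0 < gain y.
Proof. by move=> hy y0; rewrite divr_gt0 // nrm_gt0 // T_neq0. Qed.

Let gain_le y : y != 0 -> gain y <= M.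
Proof. by move=> y0; rewrite ler_pdivrMr ?nrm_gt0. Qed.

Definition unit_of y := (nrm y)^-1%:C *: y.

Let unit1 y : y != 0 -> nrm (unit_of y) = 1.
Proof.
by move=> y0; rewrite nrmZr ger0_norm ?invr_ge0 ?nrm_ge0 // mulVf // nrm_eq0.
Qed.

Let H1_unit y : H1 y -> H1 (unit_of y).
Proof. exact: H1_Z. Qed.

Let T_unit y : H1 y -> y != 0 -> T (unit_of y) = (gain y)%:C *: unit_of (T y).
Proof.
move=> hy y0; rewrite linearZR scalerA -rmorphM; congr (_%:C *: _).
by rewrite /gain mulrAC mulfV ?mul1r // nrm_eq0 T_neq0.
Qed.

(** As [rip (T (unit_of y)) (unit_of (T y))] is [gain y], the left side equals [nrm (Ts (unit_of (T
    y))) ^+ 2 - gain y ^+ 2], and [par] at [unit_of (T y)] bounds the first term. *)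
Let Ts_unit y : H1 y -> y != 0 ->
  nrm (Ts (unit_of (T y)) - (gain y)%:C *: unit_of y) ^+ 2 <=
  gain (T y) * gain (T (T y)) - gain y ^+ 2.
Proof.
move=> hy y0; have Ty0 := T_neq0 hy y0; have hTy := H1_T hy.
have TTy0 := T_neq0 hTy Ty0; have hTTy := H1_T hTy.
have TTTy0 := T_neq0 hTTy TTy0.
rewrite sqr_nrmB nrmZr ripZr ripC -adj T_unit // ripZl -nrm_sqr !unit1 //.
rewrite !mulr1 expr1n mulr1 real_normK ?num_real //.
have := par (unit_of (T y)); rewrite unit1 // T_unit // linearZR T_unit //.
rewrite 2!nrmZr unit1 // !ger0_norm ?(ltW (gain_gt0 _ _)) //.
lra.
Qed.

Let gain_sqr_le y : H1 y -> y != 0 ->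
  gain y ^+ 2 <= gain (T y) * gain (T (T y)).
Proof.
by move=> hy y0; rewrite -subr_ge0 (le_trans _ (Ts_unit hy y0)) // sqr_ge0.
Qed.

Definition log_gain y := ln (gain y).
Definition log_gain3 y := 2 * log_gain y + log_gain (T y).

(** Take logarithms in [gain_sqr_le] and add [log_gain (T y)] to both sides. *)
Let log_gain_mono y : H1 y -> y != 0 -> log_gain3 y <= log_gain3 (T y).
Proof.
move=> hy y0; have Ty0 := T_neq0 hy y0; have hTy := H1_T hy.
have TTy0 := T_neq0 hTy Ty0; have hTTy := H1_T hTy.
have g0 := gain_gt0 hy y0; have g1 := gain_gt0 hTy Ty0; have g2 := gain_gt0 hTTy TTy0.
have : ln (gain y ^+ 2) <= ln (gain (T y) * gain (T (T y))).
  by rewrite ler_ln ?posrE; [exact: gain_sqr_le|exact: exprn_gt0|exact: mulr_gt0].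
rewrite lnXn // lnM ?posrE // -mulr_natl.
rewrite /log_gain3 /log_gain; lra.
Qed.

(** If [rho] differed from [b], [modulus_cluster] would give a cluster point, again a unit vector of
    [H1]. *)
Let rotation_limit u (rho : R) :
  (forall n, nrm (u n) = 1) -> (forall n, H1 (u n)) ->
  0 <= rho -> vanishes (fun n => Ts (T (u n)) - (rho ^+ 2)%:C *: u n) ->
  (forall v, clusters u v -> nrm v = 1 -> H1 v -> False) -> rho = b.
Proof.
move=> u1 Hu rho0 van noclu; apply/eqP; apply: contrapT => /negP rhob.
have [v cv] := modulus_cluster M0 bT bTs adj modT rho0 rhob u1 van.
apply: (noclu v cv).
  apply/eqP; rewrite -subr_eq0 -normr_le0; apply/ler_addgt0Pr => e e0.
  have [n _ un] := cv e e0 0%N.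
  have := nrm_triB (u n) v 0; have := nrm_triB v (u n) 0.
  rewrite !subr0 u1 [nrm (v - _)]nrmB add0r ler_norml; lra.
apply: H1_closed => e e0; have [n _ un] := cv e e0 0%N.
by exists (u n) => //; rewrite nrmB.
Qed.

Let no_normal_unit v : nrm v = 1 -> H1 v -> normal_part T Ts v -> False.
Proof.
move=> v1 Hv Nv; have := v1; rewrite (H1_normal Hv Nv) nrm0 => /eqP.
by rewrite eq_sym oner_eq0.
Qed.

Let rotation_fwd u (rho : R) :
  (forall n, nrm (u n) = 1) -> (forall n, H1 (u n)) ->
  0 < rho -> vanishes (fun n => T (u n) - rho%:C *: u n.+1) ->
  vanishes (fun n => Ts (u n.+1) - rho%:C *: u n) -> rho = b.
Proof.
move=> u1 Hu rho0 vT vTs; apply: (rotation_limit u1 Hu (ltW rho0)).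
  have := vanishesD (vanishes_bounded bTs vT) (vanishesZ rho vTs).
  apply: vanishes_ext => n /=.
  by rewrite (linearB Ts) (linearZR Ts) scalerBr scalerA -rmorphM -expr2 subrKA.
move=> v cv v1 Hv; apply: (no_normal_unit v1 Hv).
exact: (cluster_normal_part M0 bT bTs rho0 vT vTs cv).
Qed.

(** Along a backward orbit it is [Ts] that advances the index, so the two operators exchange roles
    in [cluster_normal_part]. *)
Let rotation_bwd u (rho : R) :
  (forall n, nrm (u n) = 1) -> (forall n, H1 (u n)) ->
  0 < rho -> vanishes (fun n => Ts (u n) - rho%:C *: u n.+1) ->
  vanishes (fun n => T (u n.+1) - rho%:C *: u n) -> rho = b.
Proof.
move=> u1 Hu rho0 vTs vT; apply: (rotation_limit u1 Hu (ltW rho0)).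
  (* The composition controls [Ts T] only at [u n.+1]. *)
  apply: vanishes_S.
  have := vanishesD (vanishes_bounded bTs vT) (vanishesZ rho vTs).
  apply: vanishes_ext => n /=.
  by rewrite (linearB Ts) (linearZR Ts) scalerBr scalerA -rmorphM -expr2 subrKA.
move=> v cv v1 Hv; apply: (no_normal_unit v1 Hv).
have [C Cv /jointly_normal_sym hC] :=
  cluster_normal_part M0 bTs bT rho0 vTs vT cv.
by exists C.
Qed.

Let cvg_gain (y : nat -> H) (l : R) :
  (forall n, H1 (y n)) -> (forall n, y n != 0) ->
  log_gain (y n) @[n --> \oo] --> l -> gain (y n) @[n --> \oo] --> expR l.
Proof.
move=> Hy y0 cl.
have -> : (fun n => gain (y n)) = (fun n => expR (log_gain (y n))).
  by apply/funext => n; rewrite /log_gain lnK // posrE gain_gt0.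
apply: continuous_cvg; last exact: cl.
exact: continuous_expR.
Qed.

Let M_gt0 y : H1 y -> y != 0 -> 0 < M.
Proof. by move=> hy y0; apply: lt_le_trans (gain_gt0 hy y0) (gain_le y0). Qed.

Let log_gain_le y : H1 y -> y != 0 -> log_gain y <= ln M.
Proof.
by move=> hy y0; rewrite /log_gain ler_ln ?posrE ?gain_gt0 ?gain_le // (M_gt0 hy).
Qed.

(** [log_gain3] is nondecreasing along the orbit and at most [3 ln M]; its limit is [3 ln rho] for
    [rho] the limit of the gains, and [rotation_fwd] identifies [rho] with [b]. *)
Lemma forward_orbit y : H1 y -> y != 0 -> 0 < b /\ log_gain3 y <= 3 * ln b.
Proof.
move=> hy y0; pose x n := iter n T y.
have Hx n : H1 (x n) by elim: n => //= n IH; exact: H1_T.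
have x0 n : x n != 0 by elim: n => //= n IH; exact: T_neq0.
pose l n := log_gain3 (x n).
have ndl : nondecreasing_seq l.
  by apply/nondecreasing_seqP => n; exact: log_gain_mono.
have ubl : has_ubound (range l).
  exists (3 * ln M) => _ [n _ <-]; rewrite /l /log_gain3.
  have := log_gain_le (Hx n) (x0 n); have := log_gain_le (Hx n.+1) (x0 n.+1).
  by rewrite /=; lra.
have cl := nondecreasing_is_cvgn ndl ubl.
set L := limn l; have {}cl : l n @[n --> \oo] --> L by [].
have l0L : log_gain3 y <= L by exact: (nondecreasing_cvgn_le ndl cl 0%N).
(* [log_gain] is bounded below too, since [log_gain3] stays above its initial value and [log_gain]
   below [ln M]. *)
pose B := `|ln M| + `|log_gain3 y|.
have eB n : `|log_gain (x n)| <= B.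
  have h1 := log_gain_le (Hx n) (x0 n); have h2 := log_gain_le (Hx n.+1) (x0 n.+1).
  have h3 : log_gain3 y <= 2 * log_gain (x n) + log_gain (x n.+1) by exact: (ndl 0%N n).
  have h4 := ler_norm (ln M); have h5 := ler_norm (- log_gain3 y).
  rewrite normrN in h5; have h6 := normr_ge0 (ln M); have h7 := normr_ge0 (log_gain3 y).
  by rewrite ler_norml /B; lra.
have ce := cvg_of_weighted_fwd eB cl.
have cg := cvg_gain Hx x0 ce; set rho := expR (L / 3) in cg.
have rho0 : 0 < rho by exact: expR_gt0.
pose u n := unit_of (x n).
have u1 n : nrm (u n) = 1 by exact: unit1.
have cgS : gain (x n.+1) @[n --> \oo] --> rho.
  by have := cg; rewrite -(cvg_shiftS (fun n => gain (x n))).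
have cgSS : gain (x n.+2) @[n --> \oo] --> rho.
  by have := cgS; rewrite -(cvg_shiftS (fun n => gain (x n.+1))).
have cd : (gain (x n) - rho) @[n --> \oo] --> 0.
  by rewrite -(subrr rho); apply: cvgB => //; exact: cvg_cst.
have cd' : `|gain (x n) - rho| @[n --> \oo] --> 0.
  by rewrite -(normr0 R); exact: cvg_norm.
have rb : rho = b.
  apply: (rotation_fwd u1 (fun n => H1_unit (Hx n)) rho0).
    apply: (vanishes_le (a := fun n => `|gain (x n) - rho|)) => // n.
    have -> : T (u n) = (gain (x n))%:C *: u n.+1 by exact: T_unit.
    by rewrite -scalerBl -rmorphB nrmZr u1 mulr1.
  have v1 : vanishes (fun n => Ts (u n.+1) - (gain (x n))%:C *: u n).
    apply: (vanishes_sqr (a := fun n => gain (x n.+1) * gain (x n.+2) - gain (x n) ^+ 2)).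
      by move=> n; exact: Ts_unit.
    rewrite -(subrr (rho * rho)); apply: cvgB; first exact: cvgM.
    exact: cvgM.
  have v2 : vanishes (fun n => (gain (x n) - rho)%:C *: u n).
    apply: (vanishes_le (a := fun n => `|gain (x n) - rho|)) => // n.
    by rewrite nrmZr u1 mulr1.
  by apply: vanishes_ext (vanishesD v1 v2) => n; rewrite rmorphB scalerBl addrA subrK.
rewrite -rb; split=> //.
by rewrite /rho expRK; move: l0L; lra.
Qed.

(** Otherwise some unit vectors of [H1] have images tending to 0. As [b != 0], they would cluster at
    a unit vector of [H1] in the kernel of [T], against [T_inj]. *)
Let bounded_below : 0 < b ->
  exists2 m : R, 0 < m & forall x, H1 x -> m * nrm x <= nrm (T x).
Proof.
move=> b0; apply: contrapT => h.
have /choice[u hu] : forall n : nat,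
    exists x, [/\ H1 x, nrm x = 1 & nrm (T x) < n.+1%:R^-1].
  move=> n; apply: contrapT => hn; apply: h; exists n.+1%:R^-1.
    by rewrite invr_gt0.
  move=> x Hx; have [->|x0] := eqVneq x 0; first by rewrite linear0 nrm0 mulr0.
  rewrite leNgt; apply/negP => hx; apply: hn; exists (unit_of x); split.
  - exact: H1_unit.
  - exact: unit1.
  rewrite linearZR nrmZr ger0_norm ?invr_ge0 ?nrm_ge0 //.
  by rewrite mulrC ltr_pdivrMr // nrm_gt0.
have c0 : (n.+1%:R^-1 : R) @[n --> \oo] --> 0 by exact: cvg_harmonic.
have vT : vanishes (fun n => T (u n)).
  by apply: (vanishes_le _ c0) => n; have [_ _ /ltW] := hu n.
have : 0 = b.
  apply: (@rotation_limit u 0) => //.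
  - by move=> n; have [] := hu n.
  - by move=> n; have [] := hu n.
  - apply: vanishes_ext (vanishes_bounded bTs vT) => n.
    by rewrite expr0n /= scale0r subr0.
  - move=> v cv v1 Hv; have := v1; rewrite (T_inj Hv) ?nrm0; last first.
      apply: nrm_small => e e0; have e2 : 0 < e / 2 by rewrite divr_gt0.
      have [N hN] := vT _ e2.
      have [n /hN{}hN un] := cv (e / 2 / (M + 1)) ltac:(by rewrite divr_gt0 // ltr_wpDl) N.
      have := nrm_triB (T v) (T (u n)) 0; rewrite !subr0 -linearB.
      have := bT (v - u n); move: un; rewrite [nrm (v - _)]nrmB ltr_pdivlMr ?ltr_wpDl //.
      have := nrm_ge0 (u n - v); lra.
    by move/eqP; rewrite eq_sym oner_eq0.
by move=> b0'; rewrite -b0' ltxx in b0.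
Qed.

(** [bounded_below] makes the image of [H1] closed; a residual in [H1] orthogonal to it is
    annihilated by [Ts], hence by [T] through [ker], hence zero. *)
Let T_surj : 0 < b -> forall y, H1 y -> exists2 x, H1 x & T x = y.
Proof.
move=> b0 y Hy; have [m m0 hm] := bounded_below b0.
pose C := [set T x | x in H1].
have CS : real_subspace C.
  split; first by exists 0; rewrite ?linear0.
  move=> t _ _ [x Hx <-] [z Hz <-]; exists (t%:C *: x + z); first exact: H1_lin.
  by rewrite linearD linearZR.
have Ccl z : adherent C z -> C z.
  move=> az.
  have /choice[x hx] : forall n : nat, exists x, H1 x /\ nrm (z - T x) < n.+1%:R^-1.
    move=> n; have [|_ [x Hx <-] zx] := az n.+1%:R^-1; first by rewrite invr_gt0.
    by exists x.
  have vz : vanishes (fun n => z - T (x n)).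
    by apply: (vanishes_le _ (cvg_harmonic (R := R))) => n; have [_ /ltW] := hx n.
  have [|l hl] := nrm_cauchy_cvg (u := x).
    move=> e e0; have me : 0 < m * e / 2 by rewrite divr_gt0 // mulr_gt0.
    have [N hN] := vz _ me; exists N => i j Ni Nj.
    rewrite -(ltr_pM2l m0); apply: le_lt_trans (hm _ (H1_D (hx i).1 (H1_N (hx j).1))) _.
    rewrite linearB; have := nrm_triB (T (x i)) z (T (x j)).
    have := hN i Ni; have := hN j Nj; rewrite [nrm (T (x i) - z)]nrmB; lra.
  exists l.
    apply: H1_closed => e e0; have [N hN] := hl e e0; exists (x N); first exact: (hx N).1.
    by rewrite nrmB hN.
  apply/eqP; rewrite -subr_eq0; apply/eqP; apply: nrm_small => e e0.
  have e2 : 0 < e / 2 by rewrite divr_gt0.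
  have [N1 h1] := vz _ e2.
  have [N2 h2] := hl (e / 2 / (M + 1)) ltac:(by rewrite divr_gt0 // ltr_wpDl).
  pose n := maxn N1 N2.
  have := h1 n (leq_maxl _ _); have := h2 n (leq_maxr _ _).
  rewrite ltr_pdivlMr ?ltr_wpDl // nrmB.
  have := nrm_triB (T l) (T (x n)) z; rewrite -linearB [nrm (T (x n) - z)]nrmB.
  have := bT (l - x n); have := nrm_ge0 (l - x n); lra.
have [p [x Hx px] hp] := projection y CS Ccl.
have Hq : H1 (y - p) by apply: H1_D => //; apply: H1_N; rewrite -px; exact: H1_T.
have Tsq : Ts (y - p) = 0.
  apply/eqP; rewrite -nrm_eq0 -sqrf_eq0 nrm_sqr -adj ripC.
  by rewrite hp //; exists (Ts (y - p)) => //; exact: H1_Ts.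
exists x => //; rewrite px; apply/esym/eqP; rewrite -subr_eq0; apply/eqP.
by apply: T_inj => //; exact/ker.
Qed.

(** Preimages inside [H1] form an infinite backward orbit, along which [log_gain3] descends to
    [3 ln b]. *)
Lemma backward_orbit y : 0 < b -> H1 y -> y != 0 -> 3 * ln b <= log_gain3 y.
Proof.
move=> b0 hy y0; have [m m0 hm] := bounded_below b0.
have /choice[pre hpre] : forall y, exists x, H1 y -> H1 x /\ T x = y.
  move=> z; have [Hz|nHz] := pselect (H1 z); last by exists 0.
  by have [x Hx Tx] := T_surj b0 Hz; exists x.
pose x n := iter n pre y.
have Hx n : H1 (x n) by elim: n => //= n IH; exact: (hpre _ IH).1.
have Tx n : T (x n.+1) = x n by exact: (hpre _ (Hx n)).2.
have x0 n : x n != 0.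
  elim: n => // n IH; apply: contra_neq IH => xn.
  by rewrite -Tx xn linear0.
have ln_m n : ln m <= log_gain (x n).
  rewrite /log_gain ler_ln ?posrE ?gain_gt0 // ler_pdivlMr ?nrm_gt0 //.
  exact: hm.
(* Starting at [x 1] gives [l n] the form required by [cvg_of_weighted_bwd]. *)
pose l n := log_gain3 (x n.+1).
have lE n : l n = 2 * log_gain (x n.+1) + log_gain (x n) by rewrite /l /log_gain3 Tx.
have nil : nonincreasing_seq l.
  apply/nonincreasing_seqP => n; rewrite /l -[in leRHS]Tx.
  exact: log_gain_mono.
have lbl : has_lbound (range l).
  exists (3 * ln m) => _ [n _ <-]; rewrite lE.
  by have := ln_m n; have := ln_m n.+1; lra.
have cl := nonincreasing_is_cvgn nil lbl.
set L := limn l; have {}cl : l n @[n --> \oo] --> L by [].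
have lL : L <= log_gain3 y.
  apply: le_trans (nonincreasing_cvgn_ge nil cl 0%N) _.
  by have := log_gain_mono (Hx 1%N) (x0 1%N); rewrite Tx.
pose B := `|ln m| + `|ln M|.
have eB n : `|log_gain (x n)| <= B.
  have h1 := log_gain_le (Hx n) (x0 n); have h2 := ln_m n.
  have h4 := ler_norm (ln M); have h5 := ler_norm (- ln m).
  rewrite normrN in h5; have h6 := normr_ge0 (ln M); have h7 := normr_ge0 (ln m).
  by rewrite ler_norml /B; lra.
have {}cl : 2 * log_gain (x n.+1) + log_gain (x n) @[n --> \oo] --> L.
  by have := cl; under eq_fun do rewrite lE.
have ce := cvg_of_weighted_bwd eB cl.
have cg := cvg_gain Hx x0 ce; set rho := expR (L / 3) in cg.
have rho0 : 0 < rho by exact: expR_gt0.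
(* With this shift, the gains [gain (x n.+1)] and [gain (x n)] bounding [Ts (u n)] both belong to
   the orbit. *)
pose u n := unit_of (x n.+1).
have u1 n : nrm (u n) = 1 by exact: unit1.
have cgS : gain (x n.+1) @[n --> \oo] --> rho.
  by have := cg; rewrite -(cvg_shiftS (fun n => gain (x n))).
have cgSS : gain (x n.+2) @[n --> \oo] --> rho.
  by have := cgS; rewrite -(cvg_shiftS (fun n => gain (x n.+1))).
have cd : (gain (x n.+2) - rho) @[n --> \oo] --> 0.
  by rewrite -(subrr rho); apply: cvgB => //; exact: cvg_cst.
have cd' : `|gain (x n.+2) - rho| @[n --> \oo] --> 0.
  by rewrite -(normr0 R); exact: cvg_norm.
have rb : rho = b.
  apply: (rotation_bwd u1 (fun n => H1_unit (Hx n.+1)) rho0); last first.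
    apply: (vanishes_le (a := fun n => `|gain (x n.+2) - rho|)) => // n.
    have -> : T (u n.+1) = (gain (x n.+2))%:C *: u n by rewrite T_unit // Tx.
    by rewrite -scalerBl -rmorphB nrmZr u1 mulr1.
  have v1 : vanishes (fun n => Ts (u n) - (gain (x n.+2))%:C *: u n.+1).
    apply: (vanishes_sqr (a := fun n => gain (x n.+1) * gain (x n) - gain (x n.+2) ^+ 2)).
      by move=> n; have := Ts_unit (Hx n.+2) (x0 n.+2); rewrite !Tx.
    rewrite -(subrr (rho * rho)); apply: cvgB; first exact: cvgM.
    exact: cvgM.
  have v2 : vanishes (fun n => (gain (x n.+2) - rho)%:C *: u n.+1).
    apply: (vanishes_le (a := fun n => `|gain (x n.+2) - rho|)) => // n.
    by rewrite nrmZr u1 mulr1.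
  by apply: vanishes_ext (vanishesD v1 v2) => n; rewrite rmorphB scalerBl addrA subrK.
rewrite -rb /rho expRK; move: lL; lra.
Qed.

Lemma nonnormal_part_eq0 y : H1 y -> y = 0.
Proof.
move=> hy; apply/eqP; apply: contrapT => /negP y0.
have b0 := (forward_orbit hy y0).1.
have l3 x : H1 x -> x != 0 -> log_gain3 x = 3 * ln b.
  move=> Hx x0; apply/eqP; rewrite eq_le backward_orbit //.
  by rewrite (forward_orbit Hx x0).2.
(* Constancy of [log_gain3] makes the bound in [Ts_unit] equal to 0. *)
have TsT x : H1 x -> x != 0 -> Ts (T x) = (gain x ^+ 2)%:C *: x.
  move=> Hx x0; have Tx0 := T_neq0 Hx x0; have HTx := H1_T Hx.
  have TTx0 := T_neq0 HTx Tx0; have HTTx := H1_T HTx.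
  have g0 := gain_gt0 Hx x0; have g1 := gain_gt0 HTx Tx0; have g2 := gain_gt0 HTTx TTx0.
  have gE : gain x ^+ 2 = gain (T x) * gain (T (T x)).
    apply: ln_inj; [exact: exprn_gt0|exact: mulr_gt0|].
    rewrite lnXn // lnM ?posrE // -mulr_natl.
    have := l3 x Hx x0; rewrite -(l3 (T x) HTx Tx0) /log_gain3 /log_gain; lra.
  have := Ts_unit Hx x0; rewrite -gE subrr => h.
  have /eqP : nrm (Ts (unit_of (T x)) - (gain x)%:C *: unit_of x) ^+ 2 = 0.
    by apply/eqP; rewrite eq_le h sqr_ge0.
  rewrite sqrf_eq0 nrm_eq0 subr_eq0 => /eqP {}h.
  have := congr1 (fun z => (nrm (T x))%:C *: z) h.
  rewrite /= -linearZR !scalerA -!rmorphM mulfV ?nrm_eq0 // rmorph1 scale1r => ->.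
  congr (_%:C *: _); rewrite /gain; field; by rewrite nrm_eq0.
have gT x : H1 x -> x != 0 -> gain (T x) ^+ 2 = gain x ^+ 2.
  move=> Hx x0; have Tx0 := T_neq0 Hx x0; have HTx := H1_T Hx.
  apply/eqP; apply: contrapT => /negP gne.
  have nx : 0 < nrm x ^+ 2 by rewrite exprn_gt0 // nrm_gt0.
  have nTx : 0 < nrm (T x) ^+ 2 by rewrite exprn_gt0 // nrm_gt0.
  (* [Ts T] is self-adjoint, so distinct eigenvalues at [x] and [T x] would
     make them orthogonal, and then [x + T x] could not be an eigenvector. *)
  have ort : rip x (T x) = 0.
    have h1 : rip (T x) (T (T x)) = gain (T x) ^+ 2 * rip x (T x).
      by rewrite adj TsT // ripZr.
    have h2 : rip (T x) (T (T x)) = gain x ^+ 2 * rip x (T x).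
      by rewrite ripC adj TsT // ripZr ripC.
    apply/eqP; have /eqP := etrans (esym h1) h2.
    by rewrite -subr_eq0 -mulrBl mulf_eq0 subr_eq0 (negPf gne).
  have xT0 : x + T x != 0.
    apply: contra_neq Tx0 => h; apply: nrm0_eq0; apply/eqP; rewrite -sqrf_eq0.
    have : rip (T x) (x + T x) = 0 by rewrite h rip0r.
    by rewrite ripDr [rip (T x) x]ripC ort add0r -nrm_sqr => ->.
  have := TsT _ (H1_D Hx HTx) xT0; set c := gain (x + T x) ^+ 2.
  rewrite !linearD TsT // TsT // => h.
  have := congr1 (rip x) h; rewrite !ripE ort !mulr0 !addr0 -nrm_sqr.
  have := congr1 (rip (T x)) h; rewrite !ripE [rip (T x) x]ripC ort !mulr0 !add0r -nrm_sqr.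
  move=> /(mulIf (lt0r_neq0 nTx)) h1 /(mulIf (lt0r_neq0 nx)) h2.
  by rewrite h1 h2 eqxx in gne.
(* [H1] is itself jointly normal: for [x = T z], the two compositions multiply [x] by [gain z ^+ 2]
   and [gain (T z) ^+ 2], which agree. *)
move/eqP: y0; apply; apply: H1_normal => //; exists H1 => // x Hx.
split; [exact: H1_T|exact: H1_Ts|].
have [->|x0] := eqVneq x 0; first by rewrite !linear0.
have [z Hz zx] := T_surj b0 Hx.
have z0 : z != 0 by apply: contra_neq x0 => z0; rewrite -zx z0 linear0.
by rewrite -zx TsT // linearZR (TsT (T z)) ?gT // ?H1_T // zx.
Qed.

(** The component of [x] orthogonal to the normal part lies in [H1], hence vanishes. *)
Lemma star_paranormal_normal x : T (Ts x) = Ts (T x).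
Proof.
have [p Np hp] := projection x (normal_part_subspace T Ts)
  (fun y => normal_part_closed M0 bT bTs (y := y)).
have := nonnormal_part_eq0 hp => /eqP; rewrite subr_eq0 => /eqP ->.
by have [] := normal_partP Np.
Qed.

End StarParanormal.

(** * Normality of [T], from its adjoint and essential modulus *)

Theorem corollary2p20 (R : realType) (H : hilbertType R)
    (T : {linear H -> H}) :
  ~ finite_dimensional H ->
  opnorm_closure (absolutely_norm_attaining H) T ->
  star_paranormal T ->
  null_space T = null_space (adjoint T) ->
  normal_operator T.
Proof.
move=> infH clT par ker x.
have [M M0 bT] := bounded_operatorP clT.1.
have [Ts TsE] := linear_adjoint bT.
have [b modT] := closure_an_modulus infH clT.
have bTs : bounded M Ts by rewrite TsE; exact: bounded_adjoint.
rewrite -TsE; apply/esym; apply: (star_paranormal_normal M0 bT bTs _ modT).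
- by move=> y z; rewrite /rip TsE (adjointP _ _ bT).
- by move=> y; have := par y; rewrite -TsE !normE -rmorphXn -rmorphM lecR.
- by move=> y; have := congr1 (fun A => A y) ker; rewrite /null_space -TsE /= => ->.
Qed.
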